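(* Let $d\in\{2,3\}$, $\eta>1$, $\omega^*>0$, and $\mathbb{W}_N=\{\eta^{n-1}\omega^*:n=1,\dots,N\}$. A source of the form $S(x)=\sum_{j=1}^mM^{(j)}\nabla\delta(x-s_j)$, with $m\ge1$, distinct points $s_j\in\Omega$, $M^{(j)}\in\mathbb{R}^{d\times d}$, and $\omega^*\ge2/\min_{j\neq j'}|s_j-s_{j'}|$, is uniquely determined by the multi-frequency measurements $\{(u(\cdot,c_\alpha\omega),T_\nu u(\cdot,c_\alpha\omega))|_\Gamma:\omega\in\mathbb{W}_N,\ \alpha=p,s\}$ when $N\to+\infty$. That is, if $S$ and $\widetilde S$ are two sources of this form with radiated fields $u$ and $\widetilde u$ satisfying $$u(\cdot,c_\alpha\omega)|_\Gamma=\widetilde u(\cdot,c_\alpha\omega)|_\Gamma,\qquad T_\nu u(\cdot,c_\alpha\omega)|_\Gamma=T_\nu\widetilde u(\cdot,c_\alpha\omega)|_\Gamma$$ for $\alpha=p,s$ and all $\omega\in\mathbb{W}_N$ and all $N\in\mathbb{N}_+$, then $S=\widetilde S$ (as distributions).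
   Context: Setting. $\Omega\subset\mathbb{R}^d$ ($d=2,3$) is a bounded domain with $C^2$ boundary $\Gamma=\partial\Omega$ and exterior unit normal $\nu$. The Lamé constants $\lambda,\mu\in\mathbb{R}$ satisfy $\mu>0$ and $d\lambda+2\mu>0$. Put $c_p=\sqrt{\lambda+2\mu}$, $c_s=\sqrt{\mu}$, and, for angular frequency $\omega>0$, $k_p=\omega/c_p$, $k_s=\omega/c_s$. Here $\delta$ is the Dirac distribution, and $M\nabla\delta$ is the vector-valued distribution with $k$-th component $\sum_lM_{kl}\partial_l\delta$. If $m=1$ the lower bound on $\omega^*$ is vacuous. Radiated field. The field $u=u(\cdot,\omega)$ radiated by $S$ solves $\omega^2u+\mu\Delta u+(\lambda+\mu)\nabla\nabla\cdot u=-S$ in $\mathbb{R}^d$ with the Kupradze–Sommerfeld radiation conditions $\lim_{r=|x|\to\infty}r^{(d-1)/2}(\partial_ru_\alpha-\mathrm ik_\alpha u_\alpha)=0$ for $\alpha=p,s$, where away from the sources $u_p=-k_p^{-2}\,\mathrm{grad}\,\mathrm{div}\,u$ and $u_s=u-u_p$. It is given by $u(x)=\int_\Omega G(x,y)S(y)\,\mathrm dy$ (in the sense of distributions in $y$, for $x\notin\{s_j\}$), where $$G(x,y)=\frac{k_s^2}{\omega^2}\Phi_{k_s}(x,y)I+\frac1{\omega^2}\nabla_x\nabla_x^\top\big(\Phi_{k_s}(x,y)-\Phi_{k_p}(x,y)\big),$$ $\Phi_k(x,y)=\frac{\mathrm i}{4}H_0^{(1)}(k|x-y|)$ for $d=2$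 and $\Phi_k(x,y)=\frac{e^{\mathrm ik|x-y|}}{4\pi|x-y|}$ for $d=3$. Traction. $T_\nu u=\sigma(u)\nu$ with $\sigma(u)=\lambda(\nabla\cdot u)I+\mu(\nabla u+\nabla u^\top)$; equivalently $T_\nu u=2\mu\,\partial_\nu u+\lambda\nu\,\mathrm{div}\,u-\mu\nu^\perp\mathrm{div}^\perp u$ for $d=2$ (with $\nu^\perp=(-\nu_2,\nu_1)^\top$, $\mathrm{div}^\perp u=-\partial_2u_1+\partial_1u_2$) and $T_\nu u=2\mu\,\partial_\nu u+\lambda\nu\,\mathrm{div}\,u+\mu\,\nu\times\mathrm{curl}\,u$ for $d=3$. *)

(* Defs.v *)
From HB Require Import structures.
From mathcomp Require Import all_boot all_order all_algebra.
From mathcomp Require Import complex.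
From mathcomp Require Import all_classical all_reals all_analysis.
Import Order.TTheory GRing.Theory Num.Theory.
Import numFieldNormedType.Exports.

Set Implicit Arguments.
Unset Strict Implicit.
Unset Printing Implicit Defensive.

Local Open Scope classical_set_scope.
Local Open Scope ring_scope.
Local Open Scope complex_scope.

Section Calculus.
Context {R : realType} {d : nat}.
Local Notation V := 'cV[R]_d.
Local Notation C := R[i].

(* The library norm on matrices is the sup norm; this is the Euclidean one. *)
Definition enorm (x : V) : R := Num.sqrt (\sum_i x i 0 ^+ 2).

Definition partial (l : 'I_d) (f : V -> R) (x : V) : R :=
  'D_(delta_mx l 0) f x.

Definition grad (f : V -> R) (x : V) : V := \col_l partial l f x.

Fixpoint Ck_on (k : nat) (U : set V) (f : V -> R) : Prop :=
  (forall x, U x -> {for x, continuous f}) /\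
  if k is k'.+1 then
    forall l, (forall x, U x -> derivable f x (delta_mx l 0)) /\
              Ck_on k' U (partial l f)
  else True.

(* R[i] carries no normed R-module structure, so complex-valued functions of a
   real variable are differentiated componentwise. *)
Definition cpartial (l : 'I_d) (f : V -> C) (x : V) : C :=
  partial l (fun z => complex.Re (f z)) x +i*
  partial l (fun z => complex.Im (f z)) x.

Definition jacobian_mx (u : V -> 'cV[C]_d) (x : V) : 'M[C]_d :=
  \matrix_(i, j) cpartial j (fun z => u z i 0) x.

Definition hessian_mx (f : V -> C) (x : V) : 'M[C]_d :=
  \matrix_(i, j) cpartial i (cpartial j f) x.

Definition test_function (phi : V -> C) : Prop :=
  (forall k, Ck_on k setT (fun x => complex.Re (phi x)) /\
             Ck_on k setT (fun x => complex.Im (phi x))) /\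
  compact (closure [set x | phi x != 0]).

(* Distributions are represented by their action on functions. The functionals
   below make sense for every function differentiable at the points where they
   are supported, so that they can also be applied to y |-> G(x, y). *)
Definition dirac_distr (s : V) : (V -> C) -> C := fun phi => phi s.

Definition diff_distr (l : 'I_d) (T : (V -> C) -> C) : (V -> C) -> C :=
  fun phi => - T (cpartial l phi).

End Calculus.

Section Domain.
Context {R : realType} {d : nat}.
Local Notation V := 'cV[R]_d.

Definition boundary (Omega : set V) : set V :=
  closure Omega `\` interior Omega.

Definition bounded_domain (Omega : set V) : Prop :=
  [/\ open Omega, connected Omega, Omega !=set0 & bounded_set Omega].

(* rho < 0 inside Omega, so that grad rho points outwards. *)
Definition local_C2_defining_function (Omega : set V) (x : V) (rho : V -> R) :=
  grad rho x != 0 /\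
  exists U : set V, [/\ open U, U x, Ck_on 2 U rho &
    forall z, U z -> (Omega z <-> rho z < 0)].

Definition C2_boundary (Omega : set V) : Prop :=
  forall x, boundary Omega x ->
    exists rho, local_C2_defining_function Omega x rho.

Definition exterior_unit_normal (Omega : set V) (x n : V) : Prop :=
  exists2 rho, local_C2_defining_function Omega x rho &
    n = (enorm (grad rho x))^-1 *: grad rho x.

End Domain.

Section Hankel.
Context {R : realType}.

Definition harmonic_number (n : nat) : R := \sum_(1 <= i < n.+1) i%:R^-1.

Definition euler_gamma : R :=
  limn (fun n : nat => harmonic_number n - ln n%:R).

Definition besselJ0 (z : R) : R :=
  limn (series (fun k : nat => (-1) ^+ k * (z / 2) ^+ k.*2 / k`!%:R ^+ 2)).

(* The ascending series of Y_0; the k = 0 term vanishes as harmonic_number 0 = 0. *)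
Definition besselY0 (z : R) : R :=
  2 / pi * ((ln (z / 2) + euler_gamma) * besselJ0 z +
    limn (series (fun k : nat =>
      (-1) ^+ k.+1 * harmonic_number k * (z / 2) ^+ k.*2 / k`!%:R ^+ 2))).

Definition hankel1_0 (z : R) : R[i] := besselJ0 z +i* besselY0 z.

Definition expi (t : R) : R[i] := cos t +i* sin t.

End Hankel.

Section Elasticity.
Context {R : realType} {d : nat}.
Variables (lambda mu : R).
Local Notation V := 'cV[R]_d.
Local Notation C := R[i].

Definition c_p : R := Num.sqrt (lambda + 2 * mu).
Definition c_s : R := Num.sqrt mu.

(* Only the dimensions d = 2 and d = 3 are meant. *)
Definition Phi (k : R) (x y : V) : C :=
  let r := enorm (x - y) in
  if d == 2%N then 'i / 4 * hankel1_0 (k * r)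
  else expi (k * r) / (4 * pi * r)%:C.

Definition green (omega : R) (x y : V) : 'M[C]_d :=
  let k_p := omega / c_p in
  let k_s := omega / c_s in
  ((k_s ^+ 2 / omega ^+ 2)%:C * Phi k_s x y)%:M +
  (omega ^- 2)%:C *: hessian_mx (fun z => Phi k_s z y - Phi k_p z y) x.

Definition stress (u : V -> 'cV[C]_d) (x : V) : 'M[C]_d :=
  let Du := jacobian_mx u x in
  (lambda%:C * \tr Du)%:M + mu%:C *: (Du + Du^T).

Definition traction (nu : V -> V) (u : V -> 'cV[C]_d) (x : V) : 'cV[C]_d :=
  stress u x *m map_mx (fun t : R => t%:C) (nu x).

End Elasticity.

Section Sources.
Context {R : realType} {d : nat}.
Local Notation V := 'cV[R]_d.
Local Notation C := R[i].

Record source := Source {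
  source_num : nat;
  source_pos : 'I_source_num -> V;
  source_moment : 'I_source_num -> 'M[R]_d
}.

(* The bound on omega_star is omega_star >= 2 / min_(j != j') |s_j - s_j'|. *)
Definition admissible_source (Omega : set V) (omega_star : R) (S : source) :=
  [/\ (1 <= source_num S)%N,
      injective (@source_pos S),
      forall j, Omega (@source_pos S j) &
      forall j j', j != j' ->
        2 / enorm (@source_pos S j - @source_pos S j') <= omega_star].

(* The k-th component of sum_j M^(j) grad delta(. - s_j). *)
Definition source_distr (S : source) (k : 'I_d) : (V -> C) -> C :=
  fun phi => \sum_j \sum_l (@source_moment S j k l)%:C *
    diff_distr l (dirac_distr (@source_pos S j)) phi.

Definition eq_distr (S S' : source) : Prop :=
  forall k phi, test_function phi -> source_distr S k phi = source_distr S' k phi.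

(* u(x) = int G(x, y) S(y) dy, the distribution S acting on y |-> G(x, y); this is
   the radiating solution of the Navier equation with right-hand side - S, evaluated away
   from the support of S. *)
Definition radiated_field (lambda mu : R) (S : source) (omega : R) (x : V) :
    'cV[C]_d :=
  \col_i \sum_k source_distr S k (fun y => green lambda mu omega x y i k).

Definition frequencies (eta omega_star : R) (N : nat) : set R :=
  [set eta ^+ n.-1 * omega_star | n in [set n : nat | (1 <= n <= N)%N]].

End Sources.

Arguments source R d : clear implicits.

(* Main.v *)
Require Import Defs.
From HB Require Import structures.
From mathcomp Require Import all_boot all_order all_algebra.
From mathcomp Require Import complex.
From mathcomp Require Import all_classical all_reals all_analysis.
From mathcomp Require Import ring lra.
Import Order.TTheory GRing.Theory Num.Theory.
Import numFieldNormedType.Exports.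

Set Implicit Arguments.
Unset Strict Implicit.
Unset Printing Implicit Defensive.

Local Open Scope classical_set_scope.
Local Open Scope ring_scope.

(** Let w be the real part of the difference of the two radiated fields at the
frequency c_s omega_star.  It is radiated by the points of both sources, which
carry the moments M for the first source and - M for the second one.

On the boundary w and its traction vanish.  The derivatives of a function that
vanishes on the boundary are normal there ([tangential_derivative]), and the
symbol a |-> mu a + (lambda + mu) (n . a) n of the Navier operator is injective
([lame_symbol_injective]); so the traction controls the gradient, and the
gradient of w vanishes on the boundary.  The same argument applies to every
derivative of w, with the Navier equation in place of the traction condition:
all derivatives of w vanish on the boundary ([cauchy_zero_diff]).

The fundamental solution is a radial function f(|z|^2) with
4 q f'' + 2 d f' + k^2 f = 0, both for d = 2 and for d = 3
([fundamental_solution_profile]).  Hence w is a polynomial in finitely many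
functions (the values of f and f' at |x - s|^2, 1 / |x - s|^2 and the
coordinates of x - s) whose derivatives are again polynomials in them.
Derivatives of such a polynomial are computed symbolically ([diff_term]), and
counting the terms bounds the n-th derivative by C A^n n! locally
([iter_diff_weight]), so that w is real analytic away from the points.  A ray
that starts at a point s of a source meets the boundary, where w vanishes to
infinite order; if the ray avoids the other points, w is therefore zero on all
of it ([field_zero_on_ray]).

When r tends to 0, the part of w that comes from s grows like r^(1 - d) on such
a ray, and the other parts stay bounded.  Thus the leading coefficient, an
explicit expression in the direction and in the total moment at s, vanishes
([kernel_singularity], [symbol_total_moment]).  It does so in almost all
directions, hence in the coordinate directions, and this forces the total
moment at s to be zero ([symbol_injective], [total_moment_zero]).  Summing
over the points gives the equality of the distributions. *)

(** * Differentiation rules for real-valued functions *)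
Section DeriveRules.
Context {R : realType} {V : normedModType R}.
Implicit Types (f g : V -> R) (x v : V) (a b : R).

Lemma is_derive_cst_fun x v a : is_derive x v (fun=> a) 0.
Proof. exact: is_derive_cst. Qed.

Lemma is_derive_add f g x v a b : is_derive x v f a -> is_derive x v g b ->
  is_derive x v (fun y => f y + g y) (a + b).
Proof. exact: is_deriveD. Qed.

Lemma is_derive_sub f g x v a b : is_derive x v f a -> is_derive x v g b ->
  is_derive x v (fun y => f y - g y) (a - b).
Proof. exact: is_deriveB. Qed.

Lemma is_derive_mul f g x v a b : is_derive x v f a -> is_derive x v g b ->
  is_derive x v (fun y => f y * g y) (a * g x + f x * b).
Proof.
move=> df dg; apply: is_derive_eq (is_deriveM df dg) _.
by rewrite addrC mulrC.
Qed.

Lemma is_derive_scale f x v a c : is_derive x v f a ->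
  is_derive x v (fun y => c * f y) (c * a).
Proof. exact: is_deriveZ. Qed.

End DeriveRules.

Section DeriveRules1.
Context {R : realType}.
Implicit Types (f g : R -> R) (x a b : R).

Lemma is_derive_var x : is_derive x (1 : R) (fun y : R => y) 1.
Proof. exact: is_derive_id. Qed.

Lemma is_derive_pow n x :
  is_derive x (1 : R) (fun y : R => y ^+ n.+1) (n.+1%:R * x ^+ n).
Proof.
apply: DeriveDef; first exact: exprn_derivable.
by rewrite exp_derive [LHS]mulr1.
Qed.

Lemma is_derive_compose f g x a b :
  is_derive (g x) (1 : R) f a -> is_derive x (1 : R) g b ->
  is_derive x (1 : R) (fun y => f (g y)) (a * b).
Proof. exact: is_derive1_comp. Qed.

Lemma is_derive_inv g x b : g x != 0 -> is_derive x (1 : R) g b ->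
  is_derive x (1 : R) (fun y => (g y)^-1) (- (g x) ^- 2 * b).
Proof. exact: is_deriveV. Qed.

Lemma is_derive_continuous f x a :
  is_derive x (1 : R) f a -> {for x, continuous f}.
Proof. by move=> [H _]; apply/differentiable_continuous/derivable1_diffP. Qed.

End DeriveRules1.
Arguments is_derive_compose {R} f g {x a b}.

(** * Functions with factorially bounded derivatives *)
Section Flat.
Context {R : realType}.

Lemma power_bound_integrate (g g' : R -> R) (c : R) (k : nat) :
  (forall u : R, 0 <= u <= 1 -> is_derive u (1 : R) g (g' u)) ->
  (forall u : R, 0 <= u <= 1 -> `|g' u| <= c * u ^+ k) ->
  g 0 = 0 -> `|g 1| <= c / k.+1%:R.
Proof.
move=> dg bg g0.
have key (s : R) : s = 1 \/ s = -1 -> s * g 1 <= c / k.+1%:R.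
  move=> hs; pose F (u : R) := c / k.+1%:R * u ^+ k.+1 - s * g u.
  have dF (u : R) : 0 <= u <= 1 -> is_derive u (1 : R) F (c * u ^+ k - s * g' u).
    move=> hu; have ? := dg u hu; rewrite /F.
    apply: (@is_derive_eq R R^o R^o _ _ _ _ (c / k.+1%:R * (k.+1%:R * u ^+ k) - s * g' u)).
      by apply: is_derive_sub; apply: is_derive_scale => //; exact: is_derive_pow.
    by rewrite mulrA divfK// pnatr_eq0.
  have cF : {within `[(0:R), 1], continuous F}.
    apply: derivable_within_continuous => u; rewrite in_itv/= => hu.
    by case: (dF u hu).
  have : F 0 <= F 1.
    have i0 : (0 : R) \in `[(0 : R), 1]%R by rewrite in_itv/= lexx ler01.
    have i1 : (1 : R) \in `[(0 : R), 1]%R by rewrite in_itv/= lexx ler01.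
    apply: (@ger0_derive1_le_cc R F 0 1 _ _ cF 0 1 i0 i1 ler01).
      move=> u; rewrite in_itv/= => /andP[u0 u1].
      have hu : 0 <= u <= 1 by rewrite !ltW.
      by case: (dF u hu).
    move=> u; rewrite in_itv/= => /andP[u0 u1].
    have hu : 0 <= u <= 1 by rewrite !ltW.
    have := dF u hu => ?; rewrite derive1E derive_val subr_ge0.
    by apply: le_trans (bg u hu); case: hs => ->; rewrite ?mul1r ?mulN1r ?ler_norm// -normrN ler_norm.
  by rewrite /F g0 !mulr0 subr0 expr1n expr0n/= mulr0 mulr1 subr_ge0.
rewrite ler_norml; apply/andP; split.
  by have := key (-1) (or_intror erefl); rewrite mulN1r lerNl.
by have := key 1 (or_introl erefl); rewrite mul1r.
Qed.

(** Taylor expansion at t1: integrating k times the bound on the derivative of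
order n + k gives a bound on h n, and the factorial in it is compensated by
the k! of the k-fold integral. *)
Lemma flat_local (h : nat -> R -> R) (t1 r C A : R) (m : nat) :
  0 < r -> 0 <= C -> 0 <= A ->
  (forall (n : nat) (t : R), `|t - t1| < r -> is_derive t (1 : R) (h n) (h n.+1 t)) ->
  (forall n t, `|t - t1| < r -> `|h n t| <= C * A ^+ n * (m + n)`!%:R) ->
  (forall n, h n t1 = 0) ->
  \forall t \near t1, forall n, h n t = 0.
Proof.
move=> r0 C0 A0 dh bh h0.
have taylor k : forall n t, `|t - t1| < r ->
   `|h n t| <= C * A ^+ (n + k) * (m + (n + k))`!%:R * `|t - t1| ^+ k / k`!%:R.
  elim: k => [|k IH] n t tr; first by rewrite addn0 expr0 fact0 divr1 mulr1 bh.
  set c := C * A ^+ (n + k.+1) * (m + (n + k.+1))`!%:R.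
  pose g (u : R) := h n (t1 + u * (t - t1)).
  pose g' (u : R) := (t - t1) * h n.+1 (t1 + u * (t - t1)).
  have cl (u : R) : 0 <= u <= 1 -> `|(t1 + u * (t - t1)) - t1| < r.
    move=> /andP[u0 u1]; rewrite addrAC subrr add0r normrM ger0_norm//.
    by apply: le_lt_trans tr; rewrite ler_piMl.
  have := @power_bound_integrate g g' (c * `|t - t1| ^+ k.+1 / k`!%:R) k.
  rewrite /g !mul0r !addr0 mul1r (addrC t1) subrK => H; apply: le_trans (H _ _ (h0 n)) _.
  - move=> u hu; rewrite /g /g'.
    have := dh n _ (cl u hu) => hd.
    have d2 : is_derive u (1 : R) (fun u : R => t1 + u * (t - t1)) (t - t1).
      apply: is_derive_eq (is_derive_add (is_derive_cst_fun _ _ _)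
        (is_derive_mul (is_derive_var _) (is_derive_cst_fun _ _ _))) _.
      by rewrite mulr0 addr0 add0r mul1r.
    by have := is_derive_compose (h n) (fun u : R => t1 + u * (t - t1)) hd d2; rewrite mulrC.
  - move=> u hu; rewrite /g' normrM.
    have := IH n.+1 _ (cl u hu).
    rewrite addrAC subrr add0r normrM exprMn addSnnS -/c => H'.
    apply: le_trans (ler_wpM2l (normr_ge0 _) H') _.
    rewrite (ger0_norm (_ : 0 <= u)); last by case/andP: hu.
    by rewrite exprS le_eqVlt; apply/orP; left; apply/eqP; ring.
  - by rewrite factS natrM invfM -!mulrA [k.+1%:R^-1 * _]mulrC.
near=> t => n.
have tr : `|t - t1| < r.
  by near: t; apply: (@cvgr_distC_lt _ _ _ (nbhs t1) _ id t1).
(* The binomial coefficient (m + n + k over k) costs 2 ^ (m + n + k), so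
   2 A |t - t1| has to be less than 1. *)
have tA : 2 * A * `|t - t1| < 1 / 2.
  apply: (@le_lt_trans _ _ ((2 * A + 1) * `|t - t1|)).
    by rewrite ler_wpM2r// lerDl.
  rewrite mulrC -ltr_pdivlMr; last by rewrite ltr_wpDl ?mulr_ge0.
  near: t; apply: (@cvgr_distC_lt _ _ _ (nbhs t1) _ id t1) => //.
  by rewrite divr_gt0 ?divr_gt0// ltr_wpDl ?mulr_ge0.
have bound k : `|h n t| <= C * A ^+ n * (m + n)`!%:R * 2 ^+ (m + n) * (1 / 2) ^+ k.
  apply: le_trans (taylor k n t tr) _.
  have -> : (m + (n + k))`!%:R = 'C(m + n + k, k)%:R * k`!%:R * (m + n)`!%:R :> R.
    rewrite -!natrM addnA; congr (_%:R).
    by have := @bin_fact (m + n + k) k (leq_addl _ _); rewrite addnK mulnA.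
  have binle : 'C(m + n + k, k)%:R <= 2 ^+ (m + n + k) :> R.
    rewrite -natrX ler_nat -[2%N]/(1 + 1)%N expnDn.
    rewrite (bigD1 (inord k : 'I_(m + n + k).+1))//= inordK ?ltnS ?leq_addl//.
    by rewrite !exp1n !muln1 leq_addr.
  rewrite [leLHS](_ : _ = C * A ^+ n * (m + n)`!%:R * (A * `|t - t1|) ^+ k * 'C(m + n + k, k)%:R); last first.
    rewrite exprMn exprD.
    have f0 : k`!%:R != 0 :> R by rewrite pnatr_eq0 -lt0n fact_gt0.
    by field.
  apply: le_trans (_ : C * A ^+ n * (m + n)`!%:R * (A * `|t - t1|) ^+ k * 2 ^+ (m + n + k) <= _).
    by rewrite ler_wpM2l ?mulr_ge0 ?exprn_ge0 ?mulr_ge0.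
  rewrite exprD [leLHS](_ : _ = C * A ^+ n * (m + n)`!%:R * 2 ^+ (m + n) * (2 * A * `|t - t1|) ^+ k); last first.
    by rewrite !exprMn; ring.
  rewrite ler_wpM2l ?mulr_ge0 ?exprn_ge0//.
  by rewrite lerXn2r ?nnegrE ?mulr_ge0// ?ltW// divr_gt0.
have lim0 : (fun k => C * A ^+ n * (m + n)`!%:R * 2 ^+ (m + n) * (1 / 2) ^+ k) @ \oo --> (0 : R).
  rewrite -[X in _ --> X](mulr0 (C * A ^+ n * (m + n)`!%:R * 2 ^+ (m + n))).
  apply: cvgMl_tmp; apply: cvg_expr.
  by rewrite ger0_norm ?divr_ge0// ltr_pdivrMr// mul1r ltr1n.
apply/eqP; rewrite -normr_le0.
by apply: (cvgr_to_ge lim0); near=> k; exact: bound.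
Unshelve. all: by end_near. Qed.

(** The set where all derivatives vanish is closed by continuity and open by
[flat_local], and the half-line is connected. *)
Lemma flat_on_halfline (h : nat -> R -> R) (t0 : R) :
  (forall (n : nat) (t : R), 0 < t -> is_derive t (1 : R) (h n) (h n.+1 t)) ->
  (forall t1, 0 < t1 -> exists r C A m,
    [/\ 0 < r, 0 <= C, 0 <= A &
     forall n t, `|t - t1| < r -> `|h n t| <= C * A ^+ n * (m + n)`!%:R]) ->
  0 < t0 -> (forall n, h n t0 = 0) ->
  forall n t, 0 < t -> h n t = 0.
Proof.
move=> dh bh t00 h0.
pose B := [set t : R | 0 < t /\ forall n, h n t = 0].
have oB : open B.
  rewrite openE => t [tp ht] /=.
  have [r [C [A [m [r0 C0 A0 Hb]]]]] := bh t tp.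
  pose r' := Num.min r t.
  have r'0 : 0 < r' by rewrite lt_min r0.
  have : \forall t' \near t, forall n, h n t' = 0.
    apply: (@flat_local h t r' C A m) => //.
      move=> n t'; rewrite lt_min => /andP[_ H]; apply: dh.
      by move: H; rewrite ltr_norml => /andP[+ _]; lra.
    by move=> n t'; rewrite lt_min => /andP[H _]; apply: Hb.
  have tpos : \forall t' \near t, 0 < t' by exact: lt_nbhsr.
  by move=> H; near do split.
have oB' : open [set t : R | 0 < t /\ exists n, h n t != 0].
  rewrite openE => t [tp [n hn]] /=.
  have tpos : \forall t' \near t, 0 < t' by exact: lt_nbhsr.
  have cn : {for t, continuous (h n)}.
    by apply: differentiable_continuous; apply/derivable1_diffP; case: (dh n t tp).
  have hn0 : \forall t' \near t, h n t' != 0.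
    exact: (@cvgr_neq0 R R^o _ _ _ (h n) (h n t) cn hn).
  by near do (split; last exists n).
pose P := [set t : R | 0 < t].
have cc : connected P.
  by apply/connected_intervalP => x y /= x0 _ z /andP[+ _]; apply: lt_le_trans.
have BE : B = P.
  apply: cc.
  - by exists t0.
  - exists B => //; apply/seteqP; split=> [t [tp ht]|t [//]].
    by split.
  - exists (~` [set t : R | 0 < t /\ exists n, h n t != 0]).
      by rewrite closedC.
    apply/seteqP; split=> t /=.
      by move=> [tp ht]; split=> // -[_ [n]]; rewrite ht eqxx.
    move=> [tp H]; split=> // n; apply/eqP/negP => /negP hn; apply: H.
    by split=> //; exists n.
move=> n t tp; have : B t by rewrite BE.
by case.
Unshelve. all: by end_near. Qed.

End Flat.

(** * A differential algebra of radial functions *)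
Section InnerProduct.
Context {R : realType} {d : nat}.
Local Notation V := 'cV[R]_d.
Implicit Types u v w : V.

Definition ip u v : R := \sum_i u i 0 * v i 0.

Lemma ipC u v : ip u v = ip v u.
Proof. by apply: eq_bigr => i _; rewrite mulrC. Qed.

Lemma ipDl u v w : ip (u + v) w = ip u w + ip v w.
Proof. by rewrite /ip -big_split; apply: eq_bigr => i _; rewrite mxE mulrDl. Qed.

Lemma ipZl a u w : ip (a *: u) w = a * ip u w.
Proof. by rewrite /ip mulr_sumr; apply: eq_bigr => i _; rewrite mxE mulrA. Qed.

Lemma ipDr u v w : ip w (u + v) = ip w u + ip w v.
Proof. by rewrite ipC ipDl !(ipC w). Qed.

Lemma ipZr a u w : ip w (a *: u) = a * ip w u.
Proof. by rewrite ipC ipZl (ipC w). Qed.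

Lemma ipN u v : ip (- u) v = - ip u v.
Proof. by rewrite -scaleN1r ipZl mulN1r. Qed.

Lemma ip_ge0 u : 0 <= ip u u.
Proof. by apply: sumr_ge0 => i _; rewrite -expr2 sqr_ge0. Qed.

Lemma ip_gt0 u : u != 0 -> 0 < ip u u.
Proof.
move=> u0; rewrite lt_neqAle ip_ge0 andbT eq_sym; apply: contra u0 => /eqP H.
apply/eqP/matrixP => i j; rewrite ord1 mxE; apply/eqP.
have /eqP := H; rewrite /ip psumr_eq0; last by move=> l _; rewrite -expr2 sqr_ge0.
by move=> /allP/(_ i (mem_index_enum _)); rewrite /= mulf_eq0 orbb.
Qed.

Lemma ip_delta u i : ip u (delta_mx i 0) = u i 0.
Proof.
rewrite /ip (bigD1 i)//= mxE !eqxx mulr1 big1 ?addr0// => j ji.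
by rewrite mxE (negbTE ji) mulr0.
Qed.

Lemma ip_delta2 i j : ip (delta_mx i 0) (delta_mx j 0 : V) = (i == j)%:R.
Proof. by rewrite ip_delta mxE eqxx andbT eq_sym. Qed.

Definition l1norm u : R := \sum_i `|u i 0|.

Lemma l1norm_ge0 u : 0 <= l1norm u. Proof. exact: sumr_ge0. Qed.

Lemma le_coord_l1norm u i : `|u i 0| <= l1norm u.
Proof. by rewrite /l1norm (bigD1 i)//= lerDl sumr_ge0. Qed.

Lemma ip_le_coord u v K : 0 <= K -> (forall i, `|u i 0| <= K) ->
  `|ip u v| <= K * l1norm v.
Proof.
move=> K0 H; rewrite /ip (le_trans (ler_norm_sum _ _ _))// mulr_sumr.
by apply: ler_sum => i _; rewrite normrM ler_wpM2r.
Qed.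

End InnerProduct.

Section Terms.
Context {R : realType} {d : nat} {I : Type}.
Local Notation V := 'cV[R]_d.

(** The generators attached to the point p, seen from the relative position z p
of the observer: with q = |z p|^2, [Val a p] is f0 a q, [Slope a p] is the
derivative f1 a q, [InvSq p] is 1 / q and [Lin p u] is the inner product of
z p with u.  The booleans distinguish shear waves (true) from pressure waves
(false).  Linear forms in arbitrary directions u rather than coordinates make
the directional derivative of a generator a single product. *)
Inductive atom :=
  Val of bool & I | Slope of bool & I | InvSq of I | Lin of I & V.

Inductive term :=
  Cst of R | Atom of atom | Add of term & term | Mul of term & term.

Variables (k : bool -> R) (f0 f1 : bool -> R -> R).

Definition atom_eval (z : I -> V) (g : atom) : R :=
  match g with
  | Val a p => f0 a (ip (z p) (z p))
  | Slope a p => f1 a (ip (z p) (z p))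
  | InvSq p => (ip (z p) (z p))^-1
  | Lin p u => ip (z p) u
  end.

Fixpoint eval (z : I -> V) (e : term) : R :=
  match e with
  | Cst c => c
  | Atom g => atom_eval z g
  | Add a b => eval z a + eval z b
  | Mul a b => eval z a * eval z b
  end.

(** The case of [Slope] is the radial Helmholtz equation
4 q f'' + 2 d f' + k^2 f = 0 solved for f''. *)
Definition atom_diff (v : V) (g : atom) : term :=
  match g with
  | Val a p => Mul (Cst 2) (Mul (Atom (Slope a p)) (Atom (Lin p v)))
  | Slope a p =>
      Mul (Add (Mul (Cst (- d%:R)) (Atom (Slope a p)))
               (Mul (Cst (- (k a ^+ 2 / 2))) (Atom (Val a p))))
          (Mul (Atom (InvSq p)) (Atom (Lin p v)))
  | InvSq p =>
      Mul (Cst (- 2)) (Mul (Mul (Atom (InvSq p)) (Atom (InvSq p))) (Atom (Lin p v)))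
  | Lin p u => Cst (ip v u)
  end.

Fixpoint diff_term (v : V) (e : term) : term :=
  match e with
  | Cst _ => Cst 0
  | Atom g => atom_diff v g
  | Add a b => Add (diff_term v a) (diff_term v b)
  | Mul a b => Add (Mul (diff_term v a) b) (Mul a (diff_term v b))
  end.

Lemma eval_bigsum z (J : Type) (s : seq J) (P : pred J) (F : J -> term) :
  eval z (\big[Add/Cst 0]_(j <- s | P j) F j) = \sum_(j <- s | P j) eval z (F j).
Proof. exact: (big_morph (eval z)). Qed.

Lemma diff_bigsum v (J : Type) (s : seq J) (P : pred J) (F : J -> term) :
  diff_term v (\big[Add/Cst 0]_(j <- s | P j) F j) =
  \big[Add/Cst 0]_(j <- s | P j) diff_term v (F j).
Proof. exact: (big_morph (diff_term v)). Qed.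

Lemma eval_diffD z u v e :
  eval z (diff_term (u + v) e) = eval z (diff_term u e) + eval z (diff_term v e).
Proof.
elim: e => [c|[a p|a p|p|p w]|a IHa b IHb|a IHa b IHb] /=;
  rewrite ?IHa ?IHb ?ipDr ?ipDl; ring.
Qed.

Lemma eval_diffZ z c v e :
  eval z (diff_term (c *: v) e) = c * eval z (diff_term v e).
Proof.
elim: e => [c'|[a p|a p|p|p w]|a IHa b IHb|a IHa b IHb] /=;
  rewrite ?IHa ?IHb ?ipZr ?ipZl; ring.
Qed.

(** Symmetry of second derivatives; by the Leibniz rule it is enough to have it
on the generators. *)
Lemma eval_diffC z u v e :
  eval z (diff_term u (diff_term v e)) = eval z (diff_term v (diff_term u e)).
Proof.
elim: e => [c|[a p|a p|p|p w]|a IHa b IHb|a IHa b IHb] /=;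
  rewrite ?IHa ?IHb ?(ipC u v); ring.
Qed.

Hypothesis f0_derive : forall a (q : R), 0 < q -> is_derive q (1 : R) (f0 a) (f1 a q).
Hypothesis f1_derive : forall a (q : R), 0 < q -> is_derive q (1 : R) (f1 a)
  (- (2 * d%:R * f1 a q + k a ^+ 2 * f0 a q) / (4 * q)).

Lemma sqnorm_derive (z v : V) (t : R) :
  is_derive t (1 : R) (fun s : R => ip (z + s *: v) (z + s *: v))
    (2 * ip (z + t *: v) v).
Proof.
have -> : (fun s : R => ip (z + s *: v) (z + s *: v)) =
    (fun s => ip z z + (s * (2 * ip z v) + (s * s) * ip v v)).
  by apply/funext => s; rewrite !ipDl !ipDr !ipZl !ipZr (ipC v z); ring.
apply: is_derive_eq (is_derive_add (is_derive_cst_fun _ _ _) (is_derive_add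
  (is_derive_mul (is_derive_var _) (is_derive_cst_fun _ _ _))
  (is_derive_mul (is_derive_mul (is_derive_var _) (is_derive_var _))
    (is_derive_cst_fun _ _ _)))) _.
by rewrite ipDl ipZl; ring.
Qed.

(** [diff_term] computes derivatives along lines: all relative positions move
with the same velocity v when the observer does. *)
Lemma eval_derive (z : I -> V) (v : V) (e : term) (t : R) :
  (forall p, z p + t *: v != 0) ->
  is_derive t (1 : R) (fun s : R => eval (fun p => z p + s *: v) e)
    (eval (fun p => z p + t *: v) (diff_term v e)).
Proof.
move=> hz.
have q0 p : 0 < ip (z p + t *: v) (z p + t *: v) by exact: ip_gt0.
elim: e => [c|[a p|a p|p|p w]|a IHa b IHb|a IHa b IHb] /=.
- exact: is_derive_cst_fun.
- have := is_derive_compose (f0 a) _ (f0_derive a (q0 p)) (sqnorm_derive (z p) v t).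
  by move=> H; apply: is_derive_eq H _; ring.
- have := is_derive_compose (f1 a) _ (f1_derive a (q0 p)) (sqnorm_derive (z p) v t).
  move=> H; apply: is_derive_eq H _.
  by have := lt0r_neq0 (q0 p); move: (ip _ _) => q qn0; field.
- have := is_derive_inv (lt0r_neq0 (q0 p)) (sqnorm_derive (z p) v t).
  move=> H; apply: is_derive_eq H _.
  by have := lt0r_neq0 (q0 p); move: (ip _ (_ + _)) => q qn0; field.
- have -> : (fun s : R => ip (z p + s *: v) w) = (fun s => ip (z p) w + s * ip v w).
    by apply/funext => s; rewrite ipDl ipZl.
  apply: is_derive_eq (is_derive_add (is_derive_cst_fun _ _ _)
    (is_derive_mul (is_derive_var _) (is_derive_cst_fun _ _ _))) _.
  by ring.
- exact: is_derive_add.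
- exact: is_derive_mul.
Qed.

Fixpoint degree (e : term) : nat :=
  match e with
  | Cst _ => 0
  | Atom _ => 1
  | Add a b => maxn (degree a) (degree b)
  | Mul a b => degree a + degree b
  end.

Lemma degree_diff v e : (degree (diff_term v e) <= degree e + 2)%N.
Proof.
elim: e => [c|[a p|a p|p|p w]|a IHa b IHb|a IHa b IHb] //=.
  by rewrite geq_max !(leq_trans IHa, leq_trans IHb)// leq_add2r ?leq_maxl ?leq_maxr.
rewrite geq_max -{2}addnA leq_add2l IHb andbT.
by rewrite addnAC leq_add2r.
Qed.

Section Weight.
Variable K : R.
Hypothesis K1 : 1 <= K.

(** A bound for the value of a generator when all profiles, inverse squares and
coordinates are at most K. *)
Definition atom_weight (g : atom) : R :=
  if g is Lin _ u then K * (1 + l1norm u) else K.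

Fixpoint weight (e : term) : R :=
  match e with
  | Cst c => `|c|
  | Atom g => atom_weight g
  | Add a b => weight a + weight b
  | Mul a b => weight a * weight b
  end.

Let K0 : 0 <= K. Proof. exact: le_trans ler01 K1. Qed.

Lemma weight_ge0 e : 0 <= weight e.
Proof.
elim: e => [c|[a p|a p|p|p w]|a IHa b IHb|a IHa b IHb] //=.
- by rewrite mulr_ge0// addr_ge0// l1norm_ge0.
- exact: addr_ge0.
- exact: mulr_ge0.
Qed.

Lemma eval_le_weight z e : (forall g, `|atom_eval z g| <= atom_weight g) ->
  `|eval z e| <= weight e.
Proof.
move=> H; elim: e => [c|g|a IHa b IHb|a IHa b IHb] //=.
- by rewrite (le_trans (ler_normD _ _))// lerD.
- by rewrite normrM ler_pM.
Qed.

Lemma atom_diff_weight v : exists2 L, 0 <= L &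
  forall g, weight (atom_diff v g) <= L * atom_weight g.
Proof.
set l := K * (1 + l1norm v).
have l0 : 0 <= l by rewrite mulr_ge0// addr_ge0// l1norm_ge0.
pose S := 2 + d%:R + k false ^+ 2 / 2 + k true ^+ 2 / 2 : R.
have kS a : k a ^+ 2 / 2 <= k false ^+ 2 / 2 + k true ^+ 2 / 2.
  by case: a; [rewrite lerDr|rewrite lerDl]; rewrite divr_ge0// sqr_ge0.
have k0 a : 0 <= k a ^+ 2 / 2 by rewrite divr_ge0// sqr_ge0.
have S0 : 0 <= S by rewrite !addr_ge0.
exists (S * (K * l)); first by apply: mulr_ge0 => //; exact: mulr_ge0.
move=> g.
have Kl : l <= K * l by rewrite ler_peMl.
have Kl0 : 0 <= K * l by exact: mulr_ge0.
have d0 : 0 <= d%:R :> R by [].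
have h1 := k0 false; have h2 := k0 true.
have S2 : 2 * (K * l) <= S * (K * l) by rewrite ler_wpM2r// /S; lra.
case: g => [a p|a p|p|p w] /=; rewrite ?normrN ?(ger0_norm (k0 _)) -/l.
- rewrite normr_nat; apply: le_trans S2 _.
  by rewrite ler_peMr// mulr_ge0.
- rewrite normr_nat.
  rewrite [leLHS](_ : _ = (d%:R + k a ^+ 2 / 2) * (K * l) * K); last by ring.
  rewrite ler_wpM2r// ler_wpM2r// /S.
  by have := kS a; lra.
- rewrite normr_nat [leLHS](_ : _ = 2 * (K * l) * K); last by ring.
  by rewrite ler_wpM2r.
- have S1 : 1 <= S by rewrite /S; lra.
  have := @ip_le_coord R d v w (l1norm v) (l1norm_ge0 v) (le_coord_l1norm v).
  move/le_trans; apply; rewrite ler_pM ?l1norm_ge0//.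
    apply: le_trans (_ : K * l <= _); last by rewrite ler_peMl.
    apply: le_trans Kl; rewrite /l.
    apply: le_trans (_ : 1 + l1norm v <= _); first by rewrite lerDr.
    by rewrite ler_peMl// addr_ge0// l1norm_ge0.
  apply: le_trans (_ : 1 + l1norm w <= _); first by rewrite lerDr.
  by rewrite ler_peMl// addr_ge0// l1norm_ge0.
Qed.

(** Differentiating a monomial of degree n replaces each of its n factors in
turn, whence the factor [degree e]. *)
Lemma diff_weight v : exists2 L, 0 <= L &
  forall e, weight (diff_term v e) <= L * (degree e)%:R * weight e.
Proof.
have [L L0 HL] := atom_diff_weight v; exists L => // e.
elim: e => [c|g|a IHa b IHb|a IHa b IHb] //=.
- by rewrite normr0 mulr0 mul0r.
- by rewrite mulr1.
- rewrite mulrDr lerD//; [apply: le_trans IHa _|apply: le_trans IHb _];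
    by rewrite ler_wpM2r ?weight_ge0// ler_wpM2l// ler_nat ?leq_maxl ?leq_maxr.
- have wa := weight_ge0 a; have wb := weight_ge0 b.
  rewrite natrD mulrDr mulrDl lerD//.
    by rewrite mulrA ler_wpM2r.
  by rewrite mulrCA ler_wpM2l.
Qed.

(** The degree grows by at most 2 with each derivative, so the factors collected
from [diff_weight] are degree e + 2 j for j < n; their product is at most
2 ^ n times a factorial. *)
Lemma iter_diff_weight v e : exists2 A, 0 <= A & forall n,
  weight (iter n (diff_term v) e) <= weight e * A ^+ n * (degree e + n)`!%:R.
Proof.
have [L L0 HL] := diff_weight v; exists (2 * L); first exact: mulr_ge0.
have dn n : (degree (iter n (diff_term v) e) <= degree e + 2 * n)%N.
  elim: n => [|n IH]; first by rewrite muln0 addn0.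
  by rewrite iterS (leq_trans (degree_diff _ _))// mulnS addnCA addnC leq_add2l.
have we := weight_ge0 e.
elim=> [|n IH].
  rewrite expr0 mulr1 addn0 ler_peMr// ler1n fact_gt0//.
rewrite iterS; apply: le_trans (HL _) _.
apply: le_trans (ler_wpM2l _ IH) _; first by rewrite mulr_ge0.
rewrite addnS factS natrM exprS.
set W := weight e; set F := _`!%:R; set X := (2 * L) ^+ n.
rewrite [leRHS](_ : _ = L * (2 * (degree e + n).+1%:R) * (W * X * F)); last by ring.
rewrite ler_wpM2r ?mulr_ge0 ?exprn_ge0 ?mulr_ge0//.
rewrite ler_wpM2l// -natrM ler_nat (leq_trans (dn n))//.
rewrite mulnS mulnDr addnA leq_add2r.
exact: leq_trans (leq_pmull _ (isT : 0 < 2)%N) (leq_addl _ _).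
Qed.

End Weight.
End Terms.
Arguments atom : clear implicits.
Arguments term : clear implicits.

(** * Continuation along rays *)
Lemma near_bounded_family (R : realType) (T : Type) (F : set_system T)
    (FF : Filter F) (J : finType) (f : J -> T -> R) (l : J -> R) :
  (forall j, f j x @[x --> F] --> l j) ->
  exists2 K, 1 <= K & \forall x \near F, forall j, `|f j x| <= K.
Proof.
move=> H; exists (1 + \sum_j (`|l j| + 1)).
  by rewrite lerDl sumr_ge0// => j _; rewrite addr_ge0.
apply: filter_forall => j.
apply: (@cvgr_norm_le _ R^o _ _ _ _ _ (H j)).
rewrite (bigD1 j)//= addrCA.
apply: (@lt_le_trans _ _ (`|l j| + 1)); first by rewrite ltrDl.
by rewrite lerDl addr_ge0// sumr_ge0// => i _; rewrite addr_ge0.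
Qed.

Section TermAnalysis.
Context {R : realType} {d : nat} {I : Type}.
Local Notation V := 'cV[R]_d.
Variables (k : bool -> R) (f0 f1 : bool -> R -> R).
Hypothesis f0_derive : forall a (q : R), 0 < q -> is_derive q (1 : R) (f0 a) (f1 a q).
Hypothesis f1_derive : forall a (q : R), 0 < q -> is_derive q (1 : R) (f1 a)
  (- (2 * d%:R * f1 a q + k a ^+ 2 * f0 a q) / (4 * q)).
Local Notation diff_term := (diff_term k).
Local Notation eval := (eval f0 f1).
Local Notation atom_eval := (atom_eval f0 f1).


Lemma ip_cvg (T : Type) (F : set_system T) (FF : Filter F) (a b : T -> V) (a0 b0 : V) :
  (forall i, a t i 0 @[t --> F] --> a0 i 0) ->
  (forall i, b t i 0 @[t --> F] --> b0 i 0) ->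
  ip (a t) (b t) @[t --> F] --> ip a0 b0.
Proof.
move=> Ha Hb; rewrite /ip.
apply: cvg_big => [|i _]; first exact: add_continuous.
by apply: cvgM.
Qed.

Lemma eval_cvg (T : Type) (F : set_system T) (FF : Filter F)
    (z : T -> I -> V) (z0 : I -> V) (e : term R d I) :
  (forall p, z0 p != 0) ->
  (forall p i, z t p i 0 @[t --> F] --> z0 p i 0) ->
  eval (z t) e @[t --> F] --> eval z0 e.
Proof.
move=> z00 Hz.
have Hq p : ip (z t p) (z t p) @[t --> F] --> ip (z0 p) (z0 p) by exact: ip_cvg.
have q0 p := ip_gt0 (z00 p).
elim: e => [c|[a p|a p|p|p w]|a IHa b IHb|a IHa b IHb] /=.
- exact: cvg_cst.
- by apply: (continuous_cvg _ _ (Hq p)); exact: is_derive_continuous (f0_derive a (q0 p)).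
- by apply: (continuous_cvg _ _ (Hq p)); exact: is_derive_continuous (f1_derive a (q0 p)).
- by apply: cvgV => //; exact: lt0r_neq0.
- by apply: ip_cvg => // i; exact: cvg_cst.
- exact: cvgD.
- exact: cvgM.
Qed.

End TermAnalysis.

Section RayContinuation.
Context {R : realType} {d : nat} {I : finType}.
Local Notation V := 'cV[R]_d.
Variables (k : bool -> R) (f0 f1 : bool -> R -> R).
Hypothesis f0_derive : forall a (q : R), 0 < q -> is_derive q (1 : R) (f0 a) (f1 a q).
Hypothesis f1_derive : forall a (q : R), 0 < q -> is_derive q (1 : R) (f1 a)
  (- (2 * d%:R * f1 a q + k a ^+ 2 * f0 a q) / (4 * q)).
Local Notation diff_term := (diff_term k).
Local Notation eval := (eval f0 f1).
Local Notation atom_eval := (atom_eval f0 f1).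

Lemma line_coord_cvg (z v : V) (i : 'I_d) (t0 : R) :
  (z + t *: v) i 0 @[t --> t0] --> (z + t0 *: v) i 0.
Proof.
rewrite (_ : (fun t => _) = fun t : R => z i 0 + t * v i 0).
  rewrite !mxE; apply: cvgD; first exact: cvg_cst.
  by apply: cvgM; [exact: cvg_id|exact: cvg_cst].
by apply/funext => t; rewrite !mxE.
Qed.

Lemma atoms_bounded_near (z : I -> V) (v : V) (t0 : R) :
  (forall p, z p + t0 *: v != 0) ->
  exists2 K, 1 <= K & \forall t \near t0, forall g,
    `|atom_eval (fun p => z p + t *: v) g| <= atom_weight K g.
Proof.
move=> z0.
pose zt (t : R) p := z p + t *: v.
pose J : finType := (bool * I + bool * I + I + I * 'I_d)%type.
pose f (j : J) (t : R) : R := match j with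
  | inl (inl (inl (a, p))) => eval (zt t) (Atom (Val a p))
  | inl (inl (inr (a, p))) => eval (zt t) (Atom (Slope a p))
  | inl (inr p) => eval (zt t) (Atom (InvSq p))
  | inr (p, i) => zt t p i 0
  end.
have fc j : f j t @[t --> t0] --> f j t0.
  have Hc p i : zt t p i 0 @[t --> t0] --> zt t0 p i 0 by exact: line_coord_cvg.
  by case: j => [[[[a p]|[a p]]|p]|[p i]]; rewrite /f;
    [apply: eval_cvg..|].
have [K K1 HK] := near_bounded_family _ fc.
exists K => //; near=> t.
have HKt : forall j, `|f j t| <= K by near: t; exact: HK.
have K0 : 0 <= K := le_trans ler01 K1.
case=> [a p|a p|p|p w].
- exact: (HKt (inl (inl (inl (a, p))))).
- exact: (HKt (inl (inl (inr (a, p))))).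
- exact: (HKt (inl (inr p))).
- rewrite /=; apply: le_trans (ip_le_coord _ K0 (fun i => HKt (inr (p, i)))) _.
  by rewrite ler_wpM2l// lerDr.
Unshelve. all: by end_near. Qed.

(** Real analyticity along a ray, in the form that is used: the weights give
the factorial bounds required by [flat_on_halfline]. *)
Lemma eval_flat_ray (z : I -> V) (v : V) (e : term R d I) (t0 : R) :
  (forall p (t : R), 0 < t -> z p + t *: v != 0) -> 0 < t0 ->
  (forall n, eval (fun p => z p + t0 *: v) (iter n (diff_term v) e) = 0) ->
  forall t : R, 0 < t -> eval (fun p => z p + t *: v) e = 0.
Proof.
move=> hz t00 flat.
pose h n (t : R) := eval (fun p => z p + t *: v) (iter n (diff_term v) e).
suff H : forall n (t : R), 0 < t -> h n t = 0 by move=> t tp; exact: (H 0%N t tp).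
apply: (@flat_on_halfline R h t0) => //.
- by move=> n t tp; apply: (eval_derive f0_derive f1_derive) => p; exact: hz.
- move=> t1 t1p.
  have [K K1 HK] := @atoms_bounded_near z v t1 (fun p => hz p t1 t1p).
  have [A A0 HA] := iter_diff_weight k K1 v e.
  have [r /= r0 Hr] := (nbhs_ballP _ _).1 HK.
  exists r, (weight K e), A, (degree e); split => //.
    exact: weight_ge0.
  move=> n t tr; apply: le_trans (HA n); apply: eval_le_weight => // g.
  by apply: Hr; rewrite /ball/= distrC.
Qed.

End RayContinuation.

(** * The radial profile of the fundamental solution *)
Section EntireSeries.
Context {R : realType}.
Implicit Types (c : nat -> R) (s : R).

(** The bound is preserved by termwise differentiation, so all the derived
series converge everywhere. *)
Definition entire_coef c := exists2 C, 0 <= C & forall n, `|c n| <= C / n`!%:R.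

Definition psum c s : R := limn (pseries c s).

Lemma entire_diffs c : entire_coef c -> entire_coef (pseries_diffs c).
Proof.
move=> [C C0 H]; exists C => // n; rewrite /pseries_diffs normrM normr_nat.
apply: le_trans (ler_wpM2l _ (H n.+1)) _ => //.
rewrite factS natrM invfM mulrCA mulrA mulrA mulfK//.
Qed.

Lemma entire_tail c : entire_coef c -> entire_coef (fun n => c n.+1).
Proof.
move=> [C C0 H]; exists C => // n; apply: le_trans (H n.+1) _.
rewrite ler_wpM2l// lef_pV2 ?posrE ?ltr0n ?fact_gt0//.
by rewrite ler_nat factS leq_pmull.
Qed.

Lemma entire_cvg c s : entire_coef c -> cvgn (pseries c s).
Proof.
move=> [C C0 H]; apply: normed_cvg; rewrite /normed_series_of /=.
apply: (@series_le_cvg _ _ (C *: exp_coeff `|s|)) => [//|n|n|].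
- by rewrite /exp_coeff/= mulr_ge0// divr_ge0// exprn_ge0.
- rewrite normrM normrX /exp_coeff /= [leRHS](_ : _ = C / n`!%:R * `|s| ^+ n).
    by rewrite ler_wpM2r// exprn_ge0.
  by rewrite -mulrA [_^-1 * _]mulrC.
- exact/is_cvg_seriesZ/is_cvg_series_exp_coeff.
Qed.

Lemma psum_derive c s : entire_coef c ->
  is_derive s (1 : R) (psum c) (psum (pseries_diffs c) s).
Proof.
move=> H; apply: (@pseries_snd_diffs R c (`|s| + 1)); try apply: entire_cvg => //.
- exact: entire_diffs.
- by do 2 apply: entire_diffs.
- by rewrite [ltRHS]ger0_norm ?addr_ge0// ltrDl.
Qed.

Lemma pseries_recl_cvg c s : entire_coef (fun n => c n.+1) ->
  pseries c s @ \oo --> c 0%N + s * psum (fun n => c n.+1) s.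
Proof.
move=> H; rewrite -cvg_shiftS /=.
have -> : (fun n => pseries c s n.+1) =
    (fun n => c 0%N + s * pseries (fun n => c n.+1) s n).
  apply/funext => n; rewrite /pseries /series /= big_nat_recl//= expr0 mulr1.
  congr (_ + _); rewrite mulr_sumr; apply: eq_bigr => i _.
  by rewrite exprS; ring.
apply: cvgD; first exact: cvg_cst.
by apply: cvgMl_tmp; exact: entire_cvg.
Qed.

Lemma psum_recl c s : entire_coef (fun n => c n.+1) ->
  psum c s = c 0%N + s * psum (fun n => c n.+1) s.
Proof. by move=> H; apply: cvg_lim => //; exact: pseries_recl_cvg. Qed.

Lemma psum_at0 c : entire_coef c -> psum c 0 = c 0%N.
Proof. by move=> /entire_tail H; rewrite psum_recl// mul0r addr0. Qed.

Lemma psumD c c' s : cvgn (pseries c s) -> cvgn (pseries c' s) ->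
  psum (fun n => c n + c' n) s = psum c s + psum c' s.
Proof.
move=> H H'; rewrite /psum /pseries -lim_seriesD//.
congr (limn (series _)); apply/funext => n /=.
by rewrite -mulrDl.
Qed.

Lemma cvg_pseriesD c c' s : cvgn (pseries c s) -> cvgn (pseries c' s) ->
  cvgn (pseries (fun n => c n + c' n) s).
Proof.
move=> H H'; rewrite /pseries (_ : (fun i => _) =
  (fun i => c i * s ^+ i) + (fun i => c' i * s ^+ i)); first exact: is_cvg_seriesD.
by apply/funext => n /=; rewrite mulrDl.
Qed.

Lemma psum0 s : psum (fun=> 0) s = 0.
Proof.
apply: cvg_lim => //; rewrite (_ : pseries _ _ = fun=> 0); first exact: cvg_cst.
by apply/funext => n; rewrite /pseries /series/= big1// => i _; rewrite mul0r.
Qed.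

End EntireSeries.

Section RadialProfile.
Context {R : realType}.

(** The facts about the real part f0 of the fundamental solution, as a function
of q = r^2 with derivative f1, that do not depend on its explicit form: the
radial Helmholtz equation and the behaviour at the source.  The second limit
is one order finer than the first one; the differences of two profiles of
different wavenumbers are governed by it, since the term in 1 / r^2 does not
depend on k. *)
Record radial_profile (d : nat) (c0 k : R) (f0 f1 : R -> R) : Prop := RadialProfile {
  profile_derive : forall q : R, 0 < q -> is_derive q (1 : R) f0 (f1 q);
  slope_derive : forall q : R, 0 < q -> is_derive q (1 : R) f1
    (- (2 * d%:R * f1 q + k ^+ 2 * f0 q) / (4 * q));
  slope_limit : r ^+ d * f1 (r ^+ 2) @[r --> (0 : R)^'+] --> - c0;
  second_limit :
    r ^+ (d - 2) * (2 * d%:R * f1 (r ^+ 2) + k ^+ 2 * f0 (r ^+ 2))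
      + 2 * d%:R * c0 / r ^+ 2 @[r --> (0 : R)^'+] --> - (c0 * k ^+ 2)
}.

End RadialProfile.

Section Bessel.
Context {R : realType}.
Implicit Types s : R.

(** Coefficients of J_0 and of the power series in Y_0 with respect to the
variable (z / 2)^2. *)
Definition bessel_coefJ (n : nat) : R := (-1) ^+ n / n`!%:R ^+ 2.
Definition bessel_coefY (n : nat) : R :=
  (-1) ^+ n.+1 * harmonic_number n / n`!%:R ^+ 2.

Let fact0 n : n`!%:R != 0 :> R. Proof. by rewrite pnatr_eq0 -lt0n fact_gt0. Qed.

Lemma entire_coefJ : entire_coef bessel_coefJ.
Proof.
exists 1 => // n; rewrite /bessel_coefJ normrM normrX normrN1 expr1n.
rewrite !mul1r normfV normrX normr_nat lef_pV2 ?posrE ?exprn_gt0 ?ltr0n ?fact_gt0//.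
by rewrite expr2 -natrM ler_nat leq_pmull// fact_gt0.
Qed.

Lemma harmonic_number_le (n : nat) : 0 <= (harmonic_number n : R) <= n%:R.
Proof.
rewrite /harmonic_number sumr_ge0//=.
elim: n => [|n IH]; first by rewrite big_geq.
rewrite big_nat_recr//= -[leRHS]natr1 lerD// invf_le1//.
by rewrite ler1n.
Qed.

Lemma harmonic_numberS n : harmonic_number n.+1 = harmonic_number n + n.+1%:R^-1 :> R.
Proof. by rewrite /harmonic_number big_nat_recr. Qed.

Lemma entire_coefY : entire_coef bessel_coefY.
Proof.
exists 1 => // n; rewrite /bessel_coefY !normrM normrX normrN1 expr1n !mul1r.
have /andP[h0 hn] := harmonic_number_le n.
rewrite (ger0_norm h0) normfV normrX normr_nat expr2 invfM mulrA.
rewrite ler_piMl ?invr_ge0// ler_pdivrMr ?ltr0n ?fact_gt0// mul1r.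
by rewrite (le_trans hn)// ler_nat fact_geq.
Qed.

Let J := psum bessel_coefJ.
Let J1 := psum (pseries_diffs bessel_coefJ).
Let J2 := psum (pseries_diffs (pseries_diffs bessel_coefJ)).
Let H := psum bessel_coefY.
Let H1 := psum (pseries_diffs bessel_coefY).
Let H2 := psum (pseries_diffs (pseries_diffs bessel_coefY)).

Lemma mul_psum_diffs2 (c : nat -> R) s : entire_coef c ->
  s * psum (pseries_diffs (pseries_diffs c)) s =
    psum (fun n => n%:R * pseries_diffs c n) s
  /\ cvgn (pseries (fun n => n%:R * pseries_diffs c n) s).
Proof.
move=> Hc; have Hd := entire_diffs (entire_diffs Hc).
split; first by rewrite [RHS]psum_recl// mul0r add0r.
by have /cvgP := @pseries_recl_cvg _ (fun n => n%:R * pseries_diffs c n) s Hd.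
Qed.

(** In the variable s = (z / 2)^2 the Bessel equation of order 0 reads
s y'' + y' + y = 0. *)
Lemma bessel_operator (c : nat -> R) s : entire_coef c ->
  s * psum (pseries_diffs (pseries_diffs c)) s + psum (pseries_diffs c) s + psum c s
  = psum (fun n => n.+1%:R ^+ 2 * c n.+1 + c n) s.
Proof.
move=> Hc; have [-> Hn] := mul_psum_diffs2 s Hc.
have Hd := @entire_cvg _ _ s (entire_diffs Hc).
rewrite -psumD// -psumD//; [|exact: cvg_pseriesD|exact: entire_cvg].
congr (psum _ s); apply/funext => n; rewrite /pseries_diffs; congr (_ + _).
by rewrite -natr1; ring.
Qed.

Lemma besselJ_ode s : s * J2 s + J1 s + J s = 0.
Proof.
rewrite bessel_operator; last exact: entire_coefJ.
rewrite -[RHS](psum0 s); congr (psum _ s); apply/funext => n.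
rewrite /bessel_coefJ factS natrM exprMn (exprS (-1)).
have n0 : n.+1%:R != 0 :> R by rewrite pnatr_eq0.
by have := fact0 n => ?; field; rewrite -natr1 in n0; apply/andP.
Qed.

(** The right-hand side compensates the terms produced by the logarithm in
Y_0. *)
Lemma besselY_ode s : s * H2 s + H1 s + H s = - J1 s.
Proof.
have EY := entire_coefY.
rewrite (bessel_operator s EY).
apply/eqP; rewrite -subr_eq0 opprK; apply/eqP.
rewrite -psumD; [|apply: cvg_pseriesD|].
- rewrite -[RHS](psum0 s); congr (psum _ s); apply/funext => n.
  rewrite /bessel_coefJ /bessel_coefY /pseries_diffs harmonic_numberS factS natrM exprMn !(exprS (-1)).
  have n0 : n.+1%:R != 0 :> R by rewrite pnatr_eq0.
  by have := fact0 n => ?; field; rewrite -natr1 in n0; apply/andP.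
- have [_ H'] := mul_psum_diffs2 s EY.
  have Hd := @entire_cvg _ _ s (entire_diffs EY).
  rewrite (_ : (fun n => _) = fun n => n%:R * pseries_diffs bessel_coefY n + pseries_diffs bessel_coefY n).
    exact: cvg_pseriesD.
  by apply/funext => n; rewrite /pseries_diffs -natr1; ring.
- exact: entire_cvg.
- by apply: entire_cvg; apply: entire_diffs; exact: entire_coefJ.
Qed.

End Bessel.

Section Limits.
Context {R : realType}.

Lemma near_at_right0 (P : R -> Prop) : (forall r : R, 0 < r -> P r) ->
  \forall r \near (0 : R)^'+, P r.
Proof. by move=> H; near=> r; apply: H; near: r; exact: nbhs_right_gt. Unshelve. all: by end_near. Qed.

Lemma cvg_at_right0_eq (f g : R -> R) (l : R) :
  (forall r : R, 0 < r -> f r = g r) -> g r @[r --> (0 : R)^'+] --> l ->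
  f r @[r --> (0 : R)^'+] --> l.
Proof.
move=> fg; apply: cvg_trans; apply: near_eq_cvg.
by apply: near_at_right0 => r r0; rewrite fg.
Qed.

Lemma rlimD (f g : R -> R) (a b : R) : f r @[r --> (0 : R)^'+] --> a ->
  g r @[r --> (0 : R)^'+] --> b -> f r + g r @[r --> (0 : R)^'+] --> a + b.
Proof. exact: cvgD. Qed.

Lemma rlimM (f g : R -> R) (a b : R) : f r @[r --> (0 : R)^'+] --> a ->
  g r @[r --> (0 : R)^'+] --> b -> f r * g r @[r --> (0 : R)^'+] --> a * b.
Proof. exact: cvgM. Qed.

Lemma rlimZ (c : R) (f : R -> R) (a : R) : f r @[r --> (0 : R)^'+] --> a ->
  c * f r @[r --> (0 : R)^'+] --> c * a.
Proof. exact: cvgMl_tmp. Qed.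

Arguments rlimZ c {f a} _.

Lemma cvg_at_right0_continuous (f : R -> R) : {for (0 : R), continuous f} ->
  f r @[r --> (0 : R)^'+] --> f 0.
Proof. by move=> H; apply: cvg_at_right_filter; exact: H. Qed.

Lemma sin_over_cvg (a : R) : sin (a * r) / r @[r --> (0 : R)^'+] --> a.
Proof.
have H : is_derive (0 : R) (1 : R) (fun r : R => sin (a * r)) a.
  have h1 := is_derive_scale a (is_derive_var (0 : R)).
  have h2 := is_derive_compose sin (fun r : R => a * r) (is_derive_sin (a * 0)) h1.
  by apply: is_derive_eq h2 _; rewrite mulr0 cos0 mul1r mulr1.
have [Hd Hv] := H.
have := cvg_dnbhs_at_right Hd; rewrite -/(derive _ _ _) Hv.
apply: cvg_at_right0_eq => r r0 /=.
by rewrite addr0 mulr0 sin0 subr0 [_%:A]mulr1 mulrC.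
Qed.

Lemma oneBcos_over_cvg (a : R) :
  (1 - cos (a * r)) / r ^+ 2 @[r --> (0 : R)^'+] --> a ^+ 2 / 2.
Proof.
have H := @sin_over_cvg (a / 2).
have -> : a ^+ 2 / 2 = 2 * ((a / 2) * (a / 2)) by field.
apply: (cvg_at_right0_eq _ (rlimZ _ (rlimM H H))) => r r0 /=.
have -> : a * r = a / 2 * r + a / 2 * r by field.
rewrite cosD -!expr2.
have -> : cos (a / 2 * r) ^+ 2 = 1 - sin (a / 2 * r) ^+ 2.
  by apply/eqP; rewrite eq_sym subr_eq cos2Dsin2.
by field; rewrite gt_eqF.
Qed.

Lemma sqr_ln_cvg0 (a : R) : 0 < a ->
  r ^+ 2 * ln (a * r) @[r --> (0 : R)^'+] --> (0 : R).
Proof.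
move=> a0; apply/cvgr0Pnorm_lt => e e0.
near=> r.
have r0 : 0 < r by near: r; exact: nbhs_right_gt.
have ar0 : 0 < a * r by rewrite mulr_gt0.
have ar1 : a * r < 1.
  rewrite mulrC -ltr_pdivlMr// mul1r; near: r; apply: nbhs_right_lt.
  by rewrite invr_gt0.
have lnb : `|ln (a * r)| <= (a * r)^-1.
  rewrite ler0_norm; last by rewrite ln_le0// ltW.
  by rewrite -lnV ?posrE// ltW// ln_sublinear// invr_gt0.
rewrite normrM ger0_norm ?exprn_ge0 ?ltW//.
apply: le_lt_trans (ler_wpM2l _ lnb) _; first by rewrite exprn_ge0 ?ltW.
rewrite (_ : _ / _ = r / a); last first.
  by field; rewrite !gt_eqF.
rewrite ltr_pdivrMr//; near: r; apply: nbhs_right_lt.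
by rewrite mulr_gt0.
Unshelve. all: by end_near. Qed.

End Limits.
Arguments rlimZ {R} c {f a} _.
Arguments rlimD {R f g a b} _ _.
Arguments rlimM {R f g a b} _ _.

(** For d = 3 the profile is cos (k r) / (4 pi r); c stands for pi. *)
Section Profile3.
Context {R : realType}.
Variables k c : R.
Hypothesis cn0 : c != 0.

Let g0 (s : R) := cos (k * s) / (4 * c * s).
Let g1 (s : R) := - k * sin (k * s) / (8 * c * s ^+ 2) - cos (k * s) / (8 * c * s ^+ 3).

Definition profile3 (q : R) := g0 (Num.sqrt q).
Definition slope3 (q : R) := g1 (Num.sqrt q).

Let dcos (s : R) : is_derive s (1 : R) (fun s : R => cos (k * s)) (- sin (k * s) * k).
Proof.
have h1 := is_derive_scale k (is_derive_var s).
have h2 := is_derive_compose cos (fun r : R => k * r) (is_derive_cos (k * s)) h1.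
by apply: is_derive_eq h2 _; rewrite mulr1.
Qed.

Let dsin (s : R) : is_derive s (1 : R) (fun s : R => sin (k * s)) (cos (k * s) * k).
Proof.
have h1 := is_derive_scale k (is_derive_var s).
have h2 := is_derive_compose sin (fun r : R => k * r) (is_derive_sin (k * s)) h1.
by apply: is_derive_eq h2 _; rewrite mulr1.
Qed.

Let dinvpow n (b s : R) : b != 0 -> s != 0 ->
  is_derive s (1 : R) (fun s : R => (b * s ^+ n.+1)^-1) (- n.+1%:R / (b * s ^+ n.+2)).
Proof.
move=> b0 s0.
have h := is_derive_inv (g := fun s : R => b * s ^+ n.+1) _
  (is_derive_scale b (is_derive_pow n s)).
apply: is_derive_eq (h _) _; first by rewrite mulf_neq0 ?expf_neq0.
rewrite !exprS; have sn : s ^+ n != 0 by rewrite expf_neq0.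
by field; rewrite b0 s0 sn.
Qed.

Let g0_derive (s : R) : 0 < s -> is_derive s (1 : R) g0 (2 * s * g1 s).
Proof.
move=> s0; have sn0 := lt0r_neq0 s0.
have p4 : 4 * c != 0 :> R by rewrite mulf_neq0.
have h := is_derive_mul (dcos s) (dinvpow 0 p4 sn0).
apply: is_derive_eq h _.
by rewrite /g1; field; rewrite ?cn0 ?sn0.
Qed.

Let g1_derive (s : R) : 0 < s -> is_derive s (1 : R) g1
  (2 * s * (- (6 * g1 s + k ^+ 2 * g0 s) / (4 * s ^+ 2))).
Proof.
move=> s0; have sn0 := lt0r_neq0 s0.
have p8 : 8 * c != 0 :> R by rewrite mulf_neq0.
have h := is_derive_sub
  (is_derive_mul (is_derive_scale (- k) (dsin s)) (dinvpow 1 p8 sn0))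
  (is_derive_mul (dcos s) (dinvpow 2 p8 sn0)).
apply: is_derive_eq h _.
by rewrite /g1 /g0; field; rewrite ?cn0 ?sn0.
Qed.

Lemma radial_profile3 : radial_profile 3 (8 * c)^-1 k profile3 slope3.
Proof.
have sqrt_derive (q : R) : 0 < q -> is_derive q (1 : R) Num.sqrt (2 * Num.sqrt q)^-1.
  exact: is_derive1_sqrt.
split.
- move=> q q0; have s0 : 0 < Num.sqrt q by rewrite sqrtr_gt0.
  have h := is_derive_compose g0 Num.sqrt (g0_derive s0) (sqrt_derive q q0).
  apply: is_derive_eq h _.
  by rewrite /slope3; field; rewrite gt_eqF.
- move=> q q0; have s0 : 0 < Num.sqrt q by rewrite sqrtr_gt0.
  have h := is_derive_compose g1 Num.sqrt (g1_derive s0) (sqrt_derive q q0).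
  apply: is_derive_eq h _.
  rewrite /slope3 /profile3 -[X in _ = _ / (4 * X)]sqr_sqrtr ?ltW//.
  by field; rewrite gt_eqF.
- have cont : {for (0 : R), continuous (fun r : R => - k * r * sin (k * r) / (8 * c) - cos (k * r) / (8 * c))}.
    apply: (@is_derive_continuous _ _ _ _ (is_derive_sub
     (is_derive_mul (is_derive_mul (is_derive_scale (- k) (is_derive_var _)) (dsin _)) (is_derive_cst_fun _ _ _))
     (is_derive_mul (dcos _) (is_derive_cst_fun _ _ _)))).
  have := cvg_at_right0_continuous cont.
  rewrite /= !mulr0 !mul0r cos0 sub0r mul1r.
  apply: cvg_at_right0_eq => r r0.
  rewrite /slope3 sqrtr_sqr gtr0_norm// /g1.
  by field; rewrite ?cn0 ?gt_eqF.
- have H1 := @sin_over_cvg _ k.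
  have H2 := @oneBcos_over_cvg _ k.
  have H3 : cos (k * r) @[r --> (0 : R)^'+] --> (1 : R).
    have := cvg_at_right0_continuous (is_derive_continuous (dcos 0)).
    by rewrite mulr0 cos0.
  rewrite (_ : - (_ * _) = - (6 * k / (8 * c)) * k + 6 / (8 * c) * (k ^+ 2 / 2) + k ^+ 2 / (4 * c) * 1); last first.
    by field; rewrite ?cn0.
  apply: (cvg_at_right0_eq _ (rlimD (rlimD (rlimZ _ H1) (rlimZ _ H2)) (rlimZ _ H3))) => r r0 /=.
  rewrite /slope3 /profile3 sqrtr_sqr gtr0_norm// /g1 /g0 expr1.
  by field; rewrite ?cn0 ?gt_eqF.
Qed.

End Profile3.

(** For d = 2 the profile is - Y_0 (k r) / 4, which is kappa times
(ln (k r / 2) + gamma) J + Y with kappa = - 1 / (2 pi), where J and Y are power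
series in m q = (k r / 2)^2. *)
Section Profile2.
Context {R : realType}.
Variables k gamma kappa : R.
Hypothesis k0 : 0 < k.

Let J := psum (@bessel_coefJ R).
Let J1 := psum (pseries_diffs (@bessel_coefJ R)).
Let J2 := psum (pseries_diffs (pseries_diffs (@bessel_coefJ R))).
Let Y := psum (@bessel_coefY R).
Let Y1 := psum (pseries_diffs (@bessel_coefY R)).
Let Y2 := psum (pseries_diffs (pseries_diffs (@bessel_coefY R))).
Let m := k ^+ 2 / 4.
Let lg (q : R) := ln (k * Num.sqrt q / 2) + gamma.

Definition profile2 (q : R) := kappa * (lg q * J (m * q) + Y (m * q)).
Definition slope2 (q : R) :=
  kappa * (J (m * q) / (2 * q) + m * (lg q * J1 (m * q) + Y1 (m * q))).

Let psum_scale_derive (c : nat -> R) (q : R) : entire_coef c ->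
  is_derive q (1 : R) (fun q : R => psum c (m * q)) (psum (pseries_diffs c) (m * q) * m).
Proof.
move=> Hc.
have h := is_derive_compose (psum c) (fun q : R => m * q) (psum_derive (m * q) Hc)
  (is_derive_scale m (is_derive_var q)).
by apply: is_derive_eq h _; rewrite mulr1.
Qed.

Let EJ := @entire_coefJ R.
Let EY := @entire_coefY R.

Let lg_derive (q : R) : 0 < q -> is_derive q (1 : R) lg (2 * q)^-1.
Proof.
move=> q0; have s0 : 0 < Num.sqrt q by rewrite sqrtr_gt0.
have a0 : 0 < k / 2 * Num.sqrt q by rewrite mulr_gt0// divr_gt0.
have h1 := is_derive_scale (k / 2) (is_derive1_sqrt q0).
have h2 := is_derive_compose (@ln R) (fun q => k / 2 * Num.sqrt q) (is_derive1_ln a0) h1.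
have h := is_derive_add h2 (is_derive_cst_fun q (1 : R) gamma).
have -> : lg = fun q => ln (k / 2 * Num.sqrt q) + gamma.
  by apply/funext => x; rewrite /lg mulrAC.
apply: is_derive_eq h _.
rewrite -[in RHS](sqr_sqrtr (ltW q0)).
by field; rewrite ?(gt_eqF k0) ?(gt_eqF s0).
Qed.

Lemma radial_profile2 : radial_profile 2 (- kappa / 2) k profile2 slope2.
Proof.
have lim2 : r ^+ 2 * lg (r ^+ 2) @[r --> (0 : R)^'+] --> (0 : R).
  have h1 := @sqr_ln_cvg0 _ (k / 2) (divr_gt0 k0 (ltr0n _ 2)).
  have c : {for (0 : R), continuous (fun r : R => gamma * r ^+ 2)}.
    exact: is_derive_continuous (is_derive_scale gamma (is_derive_pow 1 (0 : R))).
  have h2 := cvg_at_right0_continuous c.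
  rewrite /= expr0n/= mulr0 in h2.
  have h := rlimD h1 h2; rewrite addr0 in h.
  apply: (cvg_at_right0_eq _ h) => r r0; rewrite /lg sqrtr_sqr gtr0_norm//.
  by rewrite mulrDr (mulrC gamma) (mulrAC k).
have psum_lim (c : nat -> R) : entire_coef c -> psum c (m * r ^+ 2) @[r --> (0 : R)^'+] --> c 0%N.
  move=> Hc.
  have h := is_derive_compose (fun q => psum c (m * q)) (fun r : R => r ^+ 2)
    (psum_scale_derive _ Hc) (is_derive_pow 1 (0 : R)).
  have := cvg_at_right0_continuous (is_derive_continuous h).
  by rewrite expr0n/= mulr0 psum_at0.
split.
- move=> q q0.
  have h := is_derive_scale kappa (is_derive_add
    (is_derive_mul (lg_derive q0) (psum_scale_derive q EJ)) (psum_scale_derive q EY)).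
  apply: is_derive_eq h _; rewrite /slope2 -/J -/J1 -/Y1.
  by field; rewrite (gt_eqF q0).
- move=> q q0.
  have h2q := @is_derive_inv _ (fun q : R => 2 * q) q _ (mulf_neq0 _ (lt0r_neq0 q0))
     (is_derive_scale 2 (is_derive_var q)).
  have h := is_derive_scale kappa (is_derive_add
    (is_derive_mul (psum_scale_derive q EJ) (h2q (lt0r_neq0 (ltr0n _ 2))))
    (is_derive_scale m (is_derive_add
      (is_derive_mul (lg_derive q0) (psum_scale_derive q (entire_diffs EJ)))
      (psum_scale_derive q (entire_diffs EY))))).
  apply: is_derive_eq h _; rewrite /slope2 /profile2 -/J -/J1 -/J2 -/Y1 -/Y2.
  have e1 : J (m * q) = - (m * q * J2 (m * q) + J1 (m * q)).
    by apply/eqP; rewrite -subr_eq0 opprK addrC; apply/eqP; exact: besselJ_ode.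
  have e2 : Y (m * q) = - (m * q * Y2 (m * q) + Y1 (m * q) + J1 (m * q)).
    apply/eqP; rewrite -subr_eq0 opprK addrC -addrA addrCA addrC -addrA.
    by have := besselY_ode (m * q); rewrite -/J1 -/Y2 -/Y1 -/Y; lra.
  have -> : k ^+ 2 = 4 * m by rewrite /m; field.
  rewrite e2 e1; set j2 := J2 _; set j1 := J1 _; set y1 := Y1 _; set y2 := Y2 _.
  move: (lg q) => l; move: m => mm in j1 j2 y1 y2 *.
  by field; rewrite (gt_eqF q0).
- have hJ := psum_lim _ EJ.
  have hJ1 := psum_lim _ (entire_diffs EJ).
  have hY1 := psum_lim _ (entire_diffs EY).
  have c2 : r ^+ 2 @[r --> (0 : R)^'+] --> (0 : R).
    have := cvg_at_right0_continuous (is_derive_continuous (is_derive_pow 1 (0 : R))).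
    by rewrite expr0n.
  have h := rlimZ kappa (rlimD (rlimZ (1 / 2) hJ)
    (rlimZ m (rlimD (rlimM lim2 hJ1) (rlimM c2 hY1)))).
  have e : - (- kappa / 2) = kappa * (1 / 2 * bessel_coefJ 0 +
      m * (0 * pseries_diffs (@bessel_coefJ R) 0%N +
           0 * pseries_diffs (@bessel_coefY R) 0%N)).
    by rewrite /bessel_coefJ expr0 fact0 expr1n divr1; field.
  rewrite e; apply: (cvg_at_right0_eq _ h) => r r0.
  rewrite /slope2 -/J -/J1 -/Y1.
  by field; rewrite (gt_eqF r0).
- have hT := psum_lim _ (entire_tail EJ).
  have hJ2 := psum_lim _ (entire_diffs (entire_diffs EJ)).
  have hY := psum_lim _ EY.
  have hY1 := psum_lim _ (entire_diffs EY).
  have h := rlimZ kappa (rlimD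
     (rlimD (rlimZ (2 * m) hT)
       (rlimZ (- (4 * m ^+ 2)) (rlimM lim2 hJ2)))
     (rlimZ (4 * m) (rlimD hY hY1))).
  match type of h with (_ --> ?l) =>
    have e : - (- kappa / 2 * k ^+ 2) = l end.
    rewrite /bessel_coefJ /bessel_coefY /pseries_diffs /harmonic_number big_geq// big_nat1.
    by rewrite /= !(factS, fact0) /m; field.
  rewrite e; apply: (cvg_at_right0_eq _ h) => r r0.
  rewrite /slope2 /profile2 -/J -/J1 -/J2 -/Y1 -/Y.
  set t := psum _ _.
  have eJ : J (m * r ^+ 2) = 1 + m * r ^+ 2 * t.
    rewrite /J psum_recl; last exact: entire_tail.
    by rewrite {1}/bessel_coefJ expr0 fact0 expr1n divr1.
  (* By the Bessel equation J1 + J = - s J2, so the logarithm comes with a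
     factor r ^ 2. *)
  have e1 : J1 (m * r ^+ 2) = - (m * r ^+ 2 * J2 (m * r ^+ 2) + J (m * r ^+ 2)).
    apply/eqP; rewrite -subr_eq0 opprK; apply/eqP.
    by have := besselJ_ode (m * r ^+ 2); rewrite -/J1 -/J2 -/J; lra.
  have -> : k ^+ 2 = 4 * m by rewrite /m; field.
  rewrite e1 eJ expr0 mul1r.
  by field; rewrite (gt_eqF r0).
Qed.

End Profile2.

Section PhiProfile.
Context {R : realType}.
Local Open Scope complex_scope.

Lemma ReM_real (a : R) (z : R[i]) : complex.Re (a%:C * z) = a * complex.Re z.
Proof. by case: z => x y; rewrite /= mul0r subr0. Qed.

Lemma enorm_ip (d : nat) (x : 'cV[R]_d) : enorm x = Num.sqrt (ip x x).
Proof. by []. Qed.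

Lemma besselJ0_psum (z : R) : besselJ0 z = psum (@bessel_coefJ R) ((z / 2) ^+ 2).
Proof.
rewrite /besselJ0 /psum /pseries; congr (limn (series _)); apply/funext => n.
by rewrite /= /bessel_coefJ -exprM mul2n; ring.
Qed.

Lemma besselY0_psum (z : R) : besselY0 z =
  2 / pi * ((ln (z / 2) + euler_gamma) * psum (@bessel_coefJ R) ((z / 2) ^+ 2)
    + psum (@bessel_coefY R) ((z / 2) ^+ 2)).
Proof.
rewrite /besselY0 besselJ0_psum; congr (_ * (_ + _)).
rewrite /psum /pseries; congr (limn (series _)); apply/funext => n.
by rewrite /= /bessel_coefY -exprM mul2n; ring.
Qed.

Lemma Re_Phi2 (k : R) (x y : 'cV[R]_2) :
  complex.Re (Phi k x y) =
    profile2 k euler_gamma (- (2 * pi)^-1) (ip (x - y) (x - y)).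
Proof.
rewrite /Phi /= enorm_ip /profile2.
set s := Num.sqrt _.
have -> : ip (x - y) (x - y) = s ^+ 2 by rewrite sqr_sqrtr// ip_ge0.
rewrite besselY0_psum (_ : (k * s / 2) ^+ 2 = k ^+ 2 / 4 * s ^+ 2); last by field.
have : (pi : R) != 0 by rewrite gt_eqF// pi_gt0.
move: (pi : R) (besselJ0 _) (psum _ _) (psum _ _) (ln _ + _) => p j0 j y' l p0.
by field; rewrite p0.
Qed.

Lemma Re_Phi3 (k : R) (x y : 'cV[R]_3) :
  complex.Re (Phi k x y) = profile3 k pi (ip (x - y) (x - y)).
Proof.
rewrite /Phi enorm_ip /profile3 (_ : (3 == 2)%N = false)//; cbv zeta.
by rewrite mulrC -fmorphV ReM_real /= mulrC.
Qed.

Lemma fundamental_solution_profile (d : nat) : d = 2%N \/ d = 3%N ->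
  exists c0 (f0 f1 : R -> R -> R), 0 < c0 /\ forall k, 0 < k ->
    radial_profile d c0 k (f0 k) (f1 k) /\
    forall x y : 'cV[R]_d, complex.Re (Phi k x y) = f0 k (ip (x - y) (x - y)).
Proof.
have pi0 := @pi_gt0 R.
have pn0 := lt0r_neq0 pi0.
case=> ->.
- exists (- (- (2 * pi)^-1) / 2), (fun k => profile2 k euler_gamma (- (2 * pi)^-1)),
    (fun k => slope2 k euler_gamma (- (2 * pi)^-1)); split.
    by rewrite opprK divr_gt0// invr_gt0 mulr_gt0.
  by move=> k k0; split; [exact: radial_profile2|exact: Re_Phi2].
- exists ((8 * pi)^-1), (fun k => profile3 k pi), (fun k => slope3 k pi); split.
    by rewrite invr_gt0 mulr_gt0.
  by move=> k k0; split; [exact: radial_profile3|exact: Re_Phi3].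
Qed.

End PhiProfile.

(** * Boundaries given by defining functions *)
Section Geometry.
Context {R : realType} {d : nat}.
Local Notation V := 'cV[R]_d.

Lemma line_derive (f : V -> R) (y v : V) (s : R) :
  derivable f (y + s *: v) v ->
  is_derive s (1 : R) (fun s : R => f (y + s *: v)) ('D_v f (y + s *: v)).
Proof.
have e : (fun h : R => h^-1 *: (((fun s : R => f (y + s *: v)) \o shift s) (h *: (1 : R)) - f (y + s *: v))) =
   (fun h : R => h^-1 *: ((f \o shift (y + s *: v)) (h *: v) - f (y + s *: v))).
  apply/funext => h /=; congr (_ *: (f _ - _)).
  by rewrite [_%:A]mulr1 scalerDl addrCA.
move=> H; apply: DeriveDef; first by rewrite /derivable e.
by rewrite /derive e.
Qed.

Lemma line_continuous (x v : V) : continuous (fun t : R => x + t *: v).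
Proof.
move=> t; apply: cvgD; first exact: cvg_cst.
by apply: cvgZr_tmp; exact: cvg_id.
Qed.

(** The supremum of the parameters of points in Omega gives a boundary point. *)
Lemma segment_meets_boundary (Omega : set V) (a b : V) :
  open Omega -> Omega a -> ~ Omega b ->
  exists t : R, 0 <= t <= 1 /\ boundary Omega (a + t *: (b - a)).
Proof.
move=> oO Oa Ob.
pose g (t : R) := a + t *: (b - a).
have cg : continuous g by exact: line_continuous.
pose T := [set t : R | 0 <= t <= 1 /\ Omega (g t)].
have T0 : T 0 by split; rewrite ?lexx ?ler01// /g scale0r addr0.
have hT : has_sup T.
  by split; [exists 0|exists 1 => t [/andP[]]].
pose s := sup T.
have s0 : 0 <= s by apply: ub_le_sup => //; case: hT.
have s1 : s <= 1 by apply: ge_sup; [exists 0|move=> t [/andP[]]].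
have nO : ~ Omega (g s).
  move=> Os; have hs : s < 1.
    rewrite lt_neqAle s1 andbT; apply/eqP => s1'.
    by apply: Ob; move: Os; rewrite s1' /g scale1r addrC subrK.
  have : \forall t \near s, Omega (g t) by apply: cg; rewrite nbhsE; exists Omega.
  move=> /nbhs_ballP[e /= e0 He].
  pose t := Num.min 1 (s + e / 2).
  have st : s < t by rewrite lt_min hs ltrDl divr_gt0.
  have : T t.
    split.
      by rewrite ge_min lexx /= andbT (le_trans s0)// ltW.
    apply: He; rewrite /ball/= ltr0_norm ?subr_lt0// opprB ltrBlDl.
    rewrite (@le_lt_trans _ _ (s + e / 2))// ?ge_min ?lexx ?orbT//.
    by rewrite ltrD2l gtr_pMr// invf_lt1// ltr1n.
  move=> /(ub_le_sup hT.2); rewrite -/s.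
  by rewrite leNgt st.
exists s; split; first by rewrite s0.
split; last by move=> /interior_subset.
move=> B /cg /nbhs_ballP[e /= e0 He].
have [t Tt st] := sup_adherent e0 hT.
exists (g t); split; first by case: Tt.
apply: He; rewrite /ball/= ger0_norm.
  by rewrite ltrBlDl -ltrBlDr.
by rewrite subr_ge0; exact: ub_le_sup hT.2 _ Tt.
Qed.

End Geometry.

Section MeanValue.
Context {R : realType}.

Lemma MVT_from0 (F dF : R -> R) (c : R) :
  (forall u : R, 0 <= u <= 1 -> is_derive (u * c) (1 : R) F (dF (u * c))) ->
  exists2 u, 0 <= u <= 1 & F c - F 0 = c * dF (u * c).
Proof.
move=> H.
pose G (u : R) := F (u * c).
have dG (u : R) : 0 <= u <= 1 -> is_derive u (1 : R) G (dF (u * c) * c).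
  move=> hu; have h := is_derive_mul (is_derive_var u) (is_derive_cst_fun u (1 : R) c).
  have h2 := is_derive_compose F (fun u : R => u * c) (H u hu) h.
  by apply: is_derive_eq h2 _; rewrite mulr0 addr0 mul1r.
have cG : {within `[(0 : R), 1], continuous G}.
  apply: derivable_within_continuous => u; rewrite in_itv/= => hu.
  by case: (dG u hu).
have [u] := @MVT_segment R G (fun u => dF (u * c) * c) 0 1 ler01
  (fun u hu => dG u ltac:(by move: hu; rewrite in_itv/= => /andP[/ltW-> /ltW->])) cG.
rewrite in_itv/= /G mul1r mul0r subr0 mulr1 => hu e; exists u => //.
by rewrite e mulrC.
Qed.

End MeanValue.

Section Tangent.
Context {R : realType} {d : nat}.
Local Notation V := 'cV[R]_d.

Lemma nbhs_col_ball (x0 : V) (P : set V) : nbhs x0 P ->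
  exists2 e : R, 0 < e & forall y : V, (forall i, `|y i 0| < e) -> P (x0 + y).
Proof.
move=> /nbhs_ballP[e /= e0 He]; exists e => // y hy; apply: He; split=> // i j.
by rewrite ord1 /ball/= mxE opprD addrA subrr sub0r normrN.
Qed.

(** Continuous partial derivatives give directional derivatives: go from x0 to
x0 + t v one coordinate at a time and apply the mean value theorem to each
step. *)
Lemma C1_quotient (rho : V -> R) (U : set V) (x0 v : V) :
  open U -> U x0 ->
  (forall l x, U x -> derivable rho x (delta_mx l 0)) ->
  (forall l, {for x0, continuous (partial l rho)}) ->
  forall e : R, 0 < e -> \forall t \near (0 : R)^'+,
    `|rho (x0 + t *: v) - rho x0 - t * ip v (grad rho x0)| <= e * t.
Proof.
move=> oU Ux0 dr cr e e0.
pose e' := e / (1 + l1norm v).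
have n1 : 0 < 1 + l1norm v by rewrite ltr_pwDl// l1norm_ge0.
have e'0 : 0 < e' by rewrite divr_gt0.
have : \forall z \near x0, U z /\ forall l, `|partial l rho z - partial l rho x0| <= e'.
  apply: filterI; first by rewrite nbhsE; exists U.
  apply: (filter_forall (nbhs_filter x0) _) => l.
  exact: (@cvgr_distC_le R R^o _ _ _ (partial l rho) _ (cr l) e' e'0).
move=> /nbhs_col_ball[D D0 HD].
near=> t.
have t0 : 0 < t by near: t; exact: nbhs_right_gt.
have tD : t * (2 * (1 + l1norm v)) < D.
  rewrite -ltr_pdivlMr ?mulr_gt0//; near: t; apply: nbhs_right_lt.
  by rewrite divr_gt0// mulr_gt0.
(* The point reached after j steps is x0 + t trunc j. *)
pose trunc (j : nat) : V := \col_i (if (i < j)%N then v i 0 else 0).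
have truncS (l : 'I_d) : trunc l.+1 = trunc l + v l 0 *: delta_mx l 0.
  apply/matrixP => i j; rewrite ord1 !mxE ltnS leq_eqVlt eqxx andbT.
  have [/eqP/val_inj->|/negP il] := boolP (val i == val l).
    by rewrite ltnn eqxx/= mulr1 add0r.
  by rewrite /= (_ : (i == l) = false) ?mulr0 ?addr0//; apply/negP.
have truncd : trunc d = v.
  by apply/matrixP => i j; rewrite ord1 mxE ltn_ord.
have trunc0 : trunc 0%N = 0.
  by apply/matrixP => i j; rewrite !mxE ltn0.
have inball (l : 'I_d) (u : R) : 0 <= u <= 1 ->
    forall i, `|(t *: trunc l + (u * (t * v l 0)) *: delta_mx l 0 : V) i 0| < D.
  move=> /andP[u0 u1] i; apply: le_lt_trans tD; rewrite !mxE.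
  apply: le_trans (ler_normD _ _) _.
  rewrite mulrDr mulrDr mulr1 [leRHS](_ : _ = t * (1 + l1norm v) + t * (1 + l1norm v)); last by ring.
  have hv j : `|v j 0| <= 1 + l1norm v.
    by apply: le_trans (le_coord_l1norm v j) _; rewrite lerDr.
  have n0 := ltW n1.
  apply: lerD; rewrite !normrM (gtr0_norm t0).
    by rewrite ler_wpM2l ?(ltW t0) ?(ltW e0)//; case: ifP => _; rewrite ?hv ?normr0 ?(ltW t0) ?(ltW e0).
  rewrite (ger0_norm u0) -[leRHS]mul1r.
  rewrite -mulrA ler_pM ?mulr_ge0 ?(ltW t0) ?(ltW e0)//.
  rewrite -mulrA ler_wpM2l ?(ltW t0) ?(ltW e0)// -[leRHS]mulr1 ler_pM//.
  by case: (_ && _); rewrite ?normr1 ?normr0.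
have step (l : 'I_d) : `|rho (x0 + t *: trunc l.+1) - rho (x0 + t *: trunc l)
    - t * (v l 0 * partial l rho x0)| <= t * (`|v l 0| * e').
  have := @MVT_from0 R (fun s => rho (x0 + t *: trunc l + s *: delta_mx l 0))
    (fun s => partial l rho (x0 + t *: trunc l + s *: delta_mx l 0)) (t * v l 0).
  case.
    move=> u hu; apply: line_derive; apply: dr.
    by have [] := HD _ (inball l u hu); rewrite addrA.
  move=> u hu; rewrite scale0r addr0.
  rewrite truncS scalerDr scalerA addrA => ->.
  rewrite mulrA -mulrBr !normrM (gtr0_norm t0) -mulrA.
  rewrite ler_wpM2l ?(ltW t0) ?(ltW e0)// ler_wpM2l//.
  have [_ /(_ l)] := HD _ (inball l u hu).
  by rewrite addrA.
have -> : rho (x0 + t *: v) - rho x0 =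
    \sum_(l < d) (rho (x0 + t *: trunc l.+1) - rho (x0 + t *: trunc l)).
  rewrite -(big_mkord xpredT (fun l => rho (x0 + t *: trunc l.+1) - rho (x0 + t *: trunc l))).
  by rewrite telescope_sumr// truncd trunc0 scaler0 addr0.
rewrite /ip mulr_sumr -sumrB.
apply: le_trans (ler_norm_sum _ _ _) _.
apply: (@le_trans _ _ (\sum_(l < d) t * (`|v l 0| * e'))).
  by apply: ler_sum => l _; rewrite mxE; exact: step.
rewrite -mulr_sumr -mulr_suml mulrC ler_wpM2r ?(ltW t0) ?(ltW e0)// -/(l1norm v) /e'.
by rewrite mulrCA ler_piMr ?(ltW t0) ?(ltW e0)// ler_pdivrMr// mul1r lerDr.
Unshelve. all: by end_near. Qed.

Lemma boundary_defining_zero (Omega : set V) (x0 : V) (rho : V -> R) (U : set V) :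
  open Omega -> boundary Omega x0 -> open U -> U x0 -> {for x0, continuous rho} ->
  (forall z, U z -> (Omega z <-> rho z < 0)) -> rho x0 = 0.
Proof.
move=> oO [clO nO] oU Ux0 cr H.
have r0 : 0 <= rho x0.
  rewrite leNgt; apply/negP => /(H _ Ux0).2 Ox0; apply: nO.
  by rewrite /interior nbhsE; exists Omega.
apply/eqP; rewrite eq_le r0 andbT leNgt; apply/negP => rp.
have /clO[z [Oz [Uz rz]]] : nbhs x0 (U `&` [set z | 0 < rho z]).
  apply: filterI; first by rewrite nbhsE; exists U.
  exact: (@cvgr_gt _ _ _ _ _ _ cr 0 rp).
by have := (H _ Uz).1 Oz; rewrite ltNge (ltW rz).
Qed.

(** For small t the points x0 + t (tau - e n) and x0 + t (tau + e n) lie on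
different sides of the boundary, so f has a zero on the segment between them.
By the mean value theorem between x0 and this zero, the derivative of f in a
direction tau + s n with |s| <= e vanishes at a point near x0; let e tend
to 0. *)
Lemma tangential_derivative (Omega : set V) (x0 tau : V) (rho : V -> R)
    (f : V -> R) (Df : V -> V -> R) (n : V) :
  open Omega -> boundary Omega x0 -> local_C2_defining_function Omega x0 rho ->
  n = (enorm (grad rho x0))^-1 *: grad rho x0 ->
  ip tau (grad rho x0) = 0 ->
  (forall x, boundary Omega x -> f x = 0) ->
  (forall x u v, Df x (u + v) = Df x u + Df x v) ->
  (forall x (a : R) v, Df x (a *: v) = a * Df x v) ->
  (\forall x \near x0, forall v (s : R) y, x = y + s *: v ->
     is_derive s (1 : R) (fun s : R => f (y + s *: v)) (Df x v)) ->
  (forall v, {for x0, continuous (Df ^~ v)}) ->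
  Df x0 tau = 0.
Proof.
move=> oO bx0 [gn0 [U [oU Ux0 C2 HU]]] en tan f0 DfD DfZ df cDf.
have [cr dr] := C2.
have rx0 := boundary_defining_zero oO bx0 oU Ux0 (cr _ Ux0) HU.
set g := grad rho x0 in gn0 en tan *.
have ng0 : 0 < enorm g by rewrite enorm_ip sqrtr_gt0 ip_gt0.
have ipng : ip n g = enorm g.
  have e : ip g g = enorm g ^+ 2 by rewrite enorm_ip sqr_sqrtr// ip_ge0.
  rewrite en ipZl e.
  by field; rewrite gt_eqF.
apply/eqP; rewrite -normr_le0 leNgt; apply/negP => T0.
set T := `|Df x0 tau| in T0; set N := `|Df x0 n|.
have N0 : 0 <= N by exact: normr_ge0.
(* e (N + 2) < T contradicts the bound e (N + e) + e on T obtained below. *)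
pose e := Num.min 1 (T / (2 * (N + 2))).
have e0 : 0 < e by rewrite lt_min ltr01 divr_gt0// mulr_gt0// ltr_wpDl.
have e1 : e <= 1 by rewrite ge_min lexx.
have eT : e * (N + 2) < T.
  apply: (@le_lt_trans _ _ (T / (2 * (N + 2)) * (N + 2))).
    by rewrite ler_wpM2r ?addr_ge0// ge_min lexx orbT.
  rewrite [ltLHS](_ : _ = T / 2); last by field; rewrite gt_eqF// ltr_wpDl.
  by rewrite ltr_pdivrMr// ltr_pMr// ltr1n.
have : \forall x \near x0, (forall v (s : R) y, x = y + s *: v ->
     is_derive s (1 : R) (fun s : R => f (y + s *: v)) (Df x v)) /\
    (`|Df x tau - Df x0 tau| <= e /\ `|Df x n - Df x0 n| <= e).
  apply: filterI => //; apply: filterI.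
    exact: (@cvgr_distC_le R R^o _ _ _ (Df ^~ tau) _ (cDf tau) e e0).
  exact: (@cvgr_distC_le R R^o _ _ _ (Df ^~ n) _ (cDf n) e e0).
move=> /nbhs_col_ball[D D0 HD].
have : nbhs x0 U by rewrite nbhsE; exists U.
move=> /nbhs_col_ball[D' D'0 HD'].
have partial_cont l : {for x0, continuous (partial l rho)}.
  by have [_ [cl _]] := dr l; apply: cl.
have quot v := C1_quotient v oU Ux0 (fun l x Ux => (dr l).1 x Ux) partial_cont.
have eg0 : 0 < e * enorm g / 2 by rewrite divr_gt0// mulr_gt0.
set M := 1 + l1norm tau + l1norm n.
have M0 : 0 < M by rewrite ltr_wpDr ?l1norm_ge0// ltr_wpDr ?l1norm_ge0.
have : \forall t \near (0 : R)^'+, exists s : R,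
    [/\ 0 < t, t * M < D, `|s| <= e & f (x0 + t *: (tau + s *: n)) = 0].
  near=> t.
  have t0 : 0 < t by near: t; exact: nbhs_right_gt.
  have tD : t * M < D.
    rewrite -ltr_pdivlMr//; near: t; apply: nbhs_right_lt.
    by rewrite divr_gt0.
  have tD' : t * M < D'.
    rewrite -ltr_pdivlMr//; near: t; apply: nbhs_right_lt.
    by rewrite divr_gt0.
  have inU (s : R) : `|s| <= 1 -> U (x0 + t *: (tau + s *: n)).
    move=> hs; apply: HD' => i; apply: le_lt_trans tD'.
    rewrite !mxE normrM gtr0_norm// ler_wpM2l ?(ltW t0) ?(ltW e0)//.
    apply: le_trans (ler_normD _ _) _; rewrite normrM.
    apply: lerD; first by rewrite ler_wpDl// le_coord_l1norm.
    by rewrite -[leRHS]mul1r ler_pM// le_coord_l1norm.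
  have qp : `|rho (x0 + t *: (tau + e *: n)) - rho x0 -
      t * ip (tau + e *: n) (grad rho x0)| <= (e * enorm g / 2) * t.
    by near: t; exact: quot.
  have qm : `|rho (x0 + t *: (tau + (- e) *: n)) - rho x0 -
      t * ip (tau + (- e) *: n) (grad rho x0)| <= (e * enorm g / 2) * t.
    by near: t; exact: quot.
  have teg : 0 < t * (e * enorm g) by rewrite !mulr_gt0.
  have Om : Omega (x0 + t *: (tau + (- e) *: n)).
    apply/HU; first by apply: inU; rewrite normrN gtr0_norm.
    move: qm; rewrite rx0 subr0 -/g ipDl ipZl tan ipng add0r ler_norml => /andP[_].
    by nra.
  have nOp : ~ Omega (x0 + t *: (tau + e *: n)).
    move=> /HU H; have {}H : rho (x0 + t *: (tau + e *: n)) < 0.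
      by apply: H; apply: inU; rewrite gtr0_norm.
    move: qp; rewrite rx0 subr0 -/g ipDl ipZl tan ipng add0r ler_norml => /andP[+ _].
    by nra.
  have [s [/andP[s0 s1] bs]] := segment_meets_boundary oO Om nOp.
  exists (e * (2 * s - 1)); split => //.
    rewrite normrM (gtr0_norm e0) -[leRHS]mulr1 ler_wpM2l ?(ltW t0) ?(ltW e0)//.
    by rewrite ler_norml; lra.
  have := f0 _ bs; congr (f _ = _).
  by apply/matrixP => i j; rewrite !mxE; ring.
move=> /(@filter_ex _ _ _) [t [s [t0 tD se fs]]].
set w := tau + s *: n in fs.
have inD (u : R) : 0 <= u <= 1 -> forall i, `|((u * t) *: w) i 0| < D.
  move=> /andP[u0 u1] i; apply: le_lt_trans tD.
  rewrite !mxE normrM normrM (ger0_norm u0) (gtr0_norm t0) -mulrA.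
  rewrite -[leRHS]mul1r ler_pM ?mulr_ge0 ?(ltW t0) ?(ltW e0)// ler_wpM2l ?(ltW t0) ?(ltW e0)//.
  apply: le_trans (ler_normD _ _) _; rewrite normrM.
  apply: lerD; first by rewrite ler_wpDl// le_coord_l1norm.
  rewrite -[leRHS]mul1r ler_pM// ?le_coord_l1norm//.
  exact: le_trans se e1.
have [u hu] := @MVT_from0 R (fun s => f (x0 + s *: w)) (fun s => Df (x0 + s *: w) w) t
  (fun u hu => (HD _ (inD u hu)).1 w (u * t) x0 erefl).
rewrite fs scale0r addr0 f0// subrr => /esym/eqP.
rewrite mulf_eq0 (gt_eqF t0)/= /w DfD DfZ -/w => /eqP e2.
have [_ [h1 h2]] := HD _ (inD u hu).
set X := Df _ tau in e2 h1; set Y := Df _ n in e2 h2.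
have Ye : `|Y| <= N + e.
  rewrite -[Y](subrK (Df x0 n)); apply: le_trans (ler_normD _ _) _.
  by rewrite addrC lerD.
have Xe : `|X| <= e * (N + e).
  have -> : X = - (s * Y) by apply/eqP; rewrite -subr_eq0 opprK e2.
  by rewrite normrN normrM ler_pM.
have : T <= `|X| + e.
  rewrite /T -[Df x0 tau](subrK X) addrC; apply: le_trans (ler_normD _ _) _.
  by rewrite lerD// distrC.
rewrite leNgt => /negP; apply; apply: le_lt_trans eT.
apply: le_trans (lerD Xe (lexx e)) _.
have : e * e <= e * 1 by rewrite ler_wpM2l// ltW.
by nra.
Unshelve. all: by end_near. Qed.

End Tangent.

(** * The Navier equation *)
Section SpaceDerivatives.
Context {R : realType} {d : nat} {I : finType}.
Local Notation V := 'cV[R]_d.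
Variables (k : bool -> R) (f0 f1 : bool -> R -> R).
Hypothesis f0_derive : forall a (q : R), 0 < q -> is_derive q (1 : R) (f0 a) (f1 a q).
Hypothesis f1_derive : forall a (q : R), 0 < q -> is_derive q (1 : R) (f1 a)
  (- (2 * d%:R * f1 a q + k a ^+ 2 * f0 a q) / (4 * q)).
Local Notation D := (diff_term k).
Local Notation eval := (eval f0 f1).
Local Notation term := (term R d I).
Implicit Types (z : I -> V) (e : term) (u v x : V).

Definition away_from0 z := forall p, z p != 0.

Lemma is_derive_of_line (f : V -> R) (x v : V) (a : R) :
  is_derive (0 : R) (1 : R) (fun t : R => f (x + t *: v)) a -> is_derive x v f a.
Proof.
have e : (fun h : R => h^-1 *: (((fun s : R => f (x + s *: v)) \o shift 0) (h *: (1 : R)) - f (x + 0 *: v))) =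
   (fun h : R => h^-1 *: ((f \o shift x) (h *: v) - f x)).
  apply/funext => h /=; rewrite scale0r !addr0; congr (_ *: (f _ - _)).
  by rewrite [_%:A]mulr1 addrC.
move=> [H1 H2]; apply: DeriveDef; first by rewrite /derivable -e.
by rewrite /derive -e.
Qed.

Lemma near_line_neq0 (z v : V) (t0 : R) : z + t0 *: v != 0 ->
  \forall t \near t0, z + t *: v != 0.
Proof. by move=> z0; apply: (cvgr_neq0 _ (@line_continuous _ _ z v t0)). Qed.

Lemma near_line_away z v : away_from0 z ->
  \forall t \near (0 : R), away_from0 (fun p => z p + t *: v).
Proof.
move=> z0; apply: (filter_forall (nbhs_filter (0 : R)) _) => p.
by apply: near_line_neq0; rewrite scale0r addr0.
Qed.

Lemma eval_derive0 z v e : away_from0 z ->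
  is_derive (0 : R) (1 : R) (fun t : R => eval (fun p => z p + t *: v) e)
    (eval z (D v e)).
Proof.
move=> z0.
have e0 : (fun p => z p + 0 *: v) = z by apply/funext => p; rewrite scale0r addr0.
have := @eval_derive R d I k f0 f1 f0_derive f1_derive z v e 0.
by rewrite e0; apply => p; rewrite scale0r addr0.
Qed.

(** The terms are not normalised; equal functions have equal derivatives, which
makes [diff_term] compatible with equality of values. *)
Lemma eval_diff_ext e e' : (forall z, away_from0 z -> eval z e = eval z e') ->
  forall z v, away_from0 z -> eval z (D v e) = eval z (D v e').
Proof.
move=> H z v z0.
have h1 := eval_derive0 v e z0; have h2 := eval_derive0 v e' z0.
rewrite -(@derive_val _ _ _ _ _ _ _ h1) -(@derive_val _ _ _ _ _ _ _ h2).
apply: near_eq_derive; near=> t; apply: H.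
by near: t; exact: near_line_away.
Unshelve. all: by end_near. Qed.

Variable pts : I -> V.
Definition offsets x : I -> V := fun p => x - pts p.

Lemma rel_line x v (t : R) : offsets (x + t *: v) = fun p => offsets x p + t *: v.
Proof. by apply/funext => p; rewrite /offsets addrAC. Qed.

Lemma near_rel_away x : away_from0 (offsets x) -> \forall y \near x, away_from0 (offsets y).
Proof.
move=> x0; apply: (filter_forall (nbhs_filter x) _) => p.
apply: (@cvgr_neq0 _ _ _ _ _ (fun y => y - pts p) (x - pts p)).
  by apply: cvgB; [exact: cvg_id|exact: cvg_cst].
exact: x0.
Qed.

Lemma eval_rel_derive x v e : away_from0 (offsets x) ->
  is_derive x v (fun y => eval (offsets y) e) (eval (offsets x) (D v e)).
Proof.
move=> x0; apply: is_derive_of_line.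
under eq_fun do rewrite rel_line.
exact: eval_derive0.
Qed.

Lemma eval_rel_line_derive x v e (s : R) y : x = y + s *: v -> away_from0 (offsets x) ->
  is_derive s (1 : R) (fun s : R => eval (offsets (y + s *: v)) e) (eval (offsets x) (D v e)).
Proof.
move=> -> x0; under eq_fun do rewrite rel_line.
rewrite rel_line; apply: (eval_derive f0_derive f1_derive) => p.
by have := x0 p; rewrite rel_line.
Qed.

Lemma eval_rel_continuous x e : away_from0 (offsets x) ->
  {for x, continuous (fun y => eval (offsets y) e)}.
Proof.
move=> x0; apply: (@eval_cvg R d I k f0 f1 f0_derive f1_derive _ (nbhs x) _ offsets) => // p i.
have h : (fun y => offsets y p i 0) = (fun y : V => y i 0 - pts p i 0).
  by apply/funext => y; rewrite /offsets !mxE.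
rewrite h /offsets !mxE; apply: cvgB; last exact: cvg_cst.
exact: coord_continuous.
Qed.

End SpaceDerivatives.

Section Navier.
Context {R : realType} {d : nat} {I : finType}.
Local Notation V := 'cV[R]_d.
Variables (k : bool -> R) (f0 f1 : bool -> R -> R).
Hypothesis f0_derive : forall a (q : R), 0 < q -> is_derive q (1 : R) (f0 a) (f1 a q).
Hypothesis f1_derive : forall a (q : R), 0 < q -> is_derive q (1 : R) (f1 a)
  (- (2 * d%:R * f1 a q + k a ^+ 2 * f0 a q) / (4 * q)).
Local Notation D := (diff_term k).
Local Notation "''d_' i" := (diff_term k (delta_mx i 0)) (at level 8, i at level 2).
Local Notation eval := (eval f0 f1).
Local Notation term := (term R d I).
Implicit Types (z : I -> V) (e : term) (u v x : V) (w : 'I_d -> term).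

Variables (lambda mu omega : R).

Definition laplacian e : term := \big[Add/Cst 0]_a 'd_a ('d_a e).
Definition divergence w : term := \big[Add/Cst 0]_a 'd_a (w a).

Definition navier w i : term :=
  Add (Mul (Cst (omega ^+ 2)) (w i))
    (Add (Mul (Cst mu) (laplacian (w i)))
       (Mul (Cst (lambda + mu)) ('d_i (divergence w)))).

Definition solution w := forall z i, away_from0 z -> eval z (navier w i) = 0.

Lemma eval_laplacian_diff z v e : away_from0 z ->
  eval z (laplacian (D v e)) = eval z (D v (laplacian e)).
Proof.
move=> z0; rewrite diff_bigsum !eval_bigsum; apply: eq_bigr => a _.
rewrite -eval_diffC; apply: (eval_diff_ext f0_derive f1_derive) => // z' _.
exact: eval_diffC.
Qed.

(** The operator has constant coefficients. *)
Lemma solution_diff w v : solution w -> solution (fun i => D v (w i)).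
Proof.
move=> Hw z i z0.
have h z' : away_from0 z' -> eval z' (navier w i) = eval z' (Cst 0).
  by move=> z'0; exact: Hw.
have := eval_diff_ext f0_derive f1_derive h v z0.
move=> /= <-; rewrite !mul0r !add0r eval_laplacian_diff//.
congr (_ + (_ + _ * _)).
rewrite eval_diffC; apply: (eval_diff_ext f0_derive f1_derive) => // z' z'0.
rewrite diff_bigsum !eval_bigsum; apply: eq_bigr => a _.
exact: eval_diffC.
Qed.

Lemma solution_bigsum (J : finType) (F : J -> 'I_d -> term) :
  (forall s, solution (F s)) ->
  solution (fun i => \big[Add/Cst 0]_s F s i).
Proof.
move=> H z i z0 /=.
transitivity (\sum_s eval z (navier (F s) i)); last first.
  by rewrite big1// => s _; exact: H.
rewrite /= !big_split/= -!mulr_sumr eval_bigsum; congr (_ + (_ * _ + _ * _)).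
  under [RHS]eq_bigr do rewrite eval_bigsum.
  rewrite exchange_big/= eval_bigsum; apply: eq_bigr => a _.
  by rewrite !diff_bigsum eval_bigsum.
under [RHS]eq_bigr do rewrite diff_bigsum eval_bigsum.
rewrite exchange_big/= diff_bigsum eval_bigsum; apply: eq_bigr => a _.
by rewrite !diff_bigsum eval_bigsum.
Qed.

Lemma solution_scale w (c : R) :
  solution w -> solution (fun i => Mul (Cst c) (w i)).
Proof.
move=> H z i z0 /=.
transitivity (c * eval z (navier w i)); last by rewrite H// mulr0.
rewrite /= !diff_bigsum !eval_bigsum !mulrDr !mulr_sumr.
congr (_ + (_ + _)); [ring|..]; apply: eq_bigr => a _ /=; ring.
Qed.

(** The radial Helmholtz equation, back in Cartesian coordinates. *)
Lemma eval_laplacian_val z a p : away_from0 z ->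
  eval z (laplacian (Atom (Val a p))) = - k a ^+ 2 * eval z (Atom (Val a p)).
Proof.
move=> z0; rewrite eval_bigsum /=.
have q0 := ip_gt0 (z0 p).
set q := ip (z p) (z p) in q0 *; set f := f0 a q; set g := f1 a q.
transitivity (\sum_(b < d) (2 * g + 2 * ((- d%:R * g - k a ^+ 2 / 2 * f) / q) * (z p b 0 * z p b 0))).
  by apply: eq_bigr => b _; rewrite ip_delta2 eqxx !ip_delta mulr1n; ring.
rewrite big_split/= sumr_const card_ord -mulr_sumr -/(ip (z p) (z p)) -/q.
rewrite -[_ *+ d]mulr_natr.
by field; rewrite gt_eqF.
Qed.

Hypothesis mu0 : mu != 0.
Hypothesis lmu0 : lambda + 2 * mu != 0.
Hypothesis omega0 : omega != 0.
Hypothesis ks : k true ^+ 2 = omega ^+ 2 / mu.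
Hypothesis kp : k false ^+ 2 = omega ^+ 2 / (lambda + 2 * mu).

Definition phi_term (p : I) : term :=
  Add (Atom (Val true p)) (Mul (Cst (-1)) (Atom (Val false p))).

(** The entry (i, j) of the Green tensor with source at the point p. *)
Definition green_term (p : I) (i j : 'I_d) : term :=
  Add (Mul (Cst (k true ^+ 2 / omega ^+ 2 * (i == j)%:R)) (Atom (Val true p)))
    (Mul (Cst (omega ^- 2)) ('d_i ('d_j (phi_term p)))).

Lemma eval_laplacianD z e e' :
  eval z (laplacian (Add e e')) = eval z (laplacian e) + eval z (laplacian e').
Proof. by rewrite !eval_bigsum -big_split. Qed.

Lemma eval_laplacianZ z c e :
  eval z (laplacian (Mul (Cst c) e)) = c * eval z (laplacian e).
Proof. by rewrite !eval_bigsum mulr_sumr; apply: eq_bigr => a _ /=; ring. Qed.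

Lemma eval_diff2D z u v e e' : eval z (D u (D v (Add e e'))) =
  eval z (D u (D v e)) + eval z (D u (D v e')).
Proof. by []. Qed.

Lemma eval_diff2Z z u v c e :
  eval z (D u (D v (Mul (Cst c) e))) = c * eval z (D u (D v e)).
Proof. by rewrite /=; ring. Qed.

Lemma eval_laplacian_phi z p : away_from0 z -> eval z (laplacian (phi_term p)) =
  eval z (Add (Mul (Cst (- k true ^+ 2)) (Atom (Val true p)))
              (Mul (Cst (k false ^+ 2)) (Atom (Val false p)))).
Proof.
move=> z0.
by rewrite eval_laplacianD eval_laplacianZ !eval_laplacian_val//=; ring.
Qed.

(** By the Helmholtz equations everything reduces to second derivatives of the
two fundamental solutions, whose coefficients cancel. *)
Lemma green_solution p j : solution (fun i => green_term p i j).
Proof.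
move=> z i z0.
pose Lphi : term := Add (Mul (Cst (- k true ^+ 2)) (Atom (Val true p)))
              (Mul (Cst (k false ^+ 2)) (Atom (Val false p))).
have dd u v : eval z (D u (D v (laplacian (phi_term p)))) = eval z (D u (D v Lphi)).
  apply: (eval_diff_ext f0_derive f1_derive) => // z' z'0.
  apply: (eval_diff_ext f0_derive f1_derive) => // z'' z''0.
  exact: eval_laplacian_phi.
have di_lap v : eval z (D v (laplacian ('d_j (phi_term p)))) = eval z (D v ('d_j Lphi)).
  rewrite -dd; apply: (eval_diff_ext f0_derive f1_derive) => // z' z'0.
  exact: eval_laplacian_diff.
have lapg : eval z (laplacian (green_term p i j)) =
    k true ^+ 2 / omega ^+ 2 * (i == j)%:R * (- k true ^+ 2 * eval z (Atom (Val true p)))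
    + omega ^- 2 * eval z ('d_i ('d_j Lphi)).
  rewrite eval_laplacianD !eval_laplacianZ eval_laplacian_val//.
  by rewrite eval_laplacian_diff// di_lap.
have divg : eval z ('d_i (divergence (fun a => green_term p a j))) =
    k true ^+ 2 / omega ^+ 2 * eval z ('d_i ('d_j (Atom (Val true p))))
    + omega ^- 2 * eval z ('d_i ('d_j Lphi)).
  rewrite -di_lap !diff_bigsum !eval_bigsum mulr_sumr.
  have -> : eval z ('d_i ('d_j (Atom (Val true p)))) =
     \sum_a (a == j)%:R * eval z ('d_i ('d_a (Atom (Val true p)))).
    rewrite (bigD1 j)//= eqxx mul1r big1 ?addr0// => a /negbTE ->.
    by rewrite mul0r.
  rewrite mulr_sumr -big_split; apply: eq_bigr => a _.
  by rewrite eval_diff2D !eval_diff2Z mulrA.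
rewrite -[LHS]/(omega ^+ 2 * eval z (green_term p i j) + (mu * eval z (laplacian (green_term p i j))
  + (lambda + mu) * eval z ('d_i (divergence (fun a => green_term p a j))))) lapg divg.
have -> : eval z (green_term p i j) =
    k true ^+ 2 / omega ^+ 2 * (i == j)%:R * eval z (Atom (Val true p)) + omega ^- 2 *
     (eval z ('d_i ('d_j (Atom (Val true p)))) - eval z ('d_i ('d_j (Atom (Val false p))))).
  rewrite -[LHS]/(k true ^+ 2 / omega ^+ 2 * (i == j)%:R * eval z (Atom (Val true p))
    + omega ^- 2 * eval z ('d_i ('d_j (phi_term p)))).
  by rewrite eval_diff2D eval_diff2Z mulN1r.
have -> : eval z ('d_i ('d_j Lphi)) = - k true ^+ 2 * eval z ('d_i ('d_j (Atom (Val true p))))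
   + k false ^+ 2 * eval z ('d_i ('d_j (Atom (Val false p)))).
  by rewrite eval_diff2D !eval_diff2Z.
move: (eval z _) (eval z _) (eval z _) => A B C.
by rewrite ks kp; field; rewrite omega0 mu0 lmu0.
Qed.

End Navier.

(** * Vanishing Cauchy data propagate to all derivatives *)
Section CauchyData.
Context {R : realType} {d : nat} {I : finType}.
Local Notation V := 'cV[R]_d.
Variables (k : bool -> R) (f0 f1 : bool -> R -> R).
Hypothesis f0_derive : forall a (q : R), 0 < q -> is_derive q (1 : R) (f0 a) (f1 a q).
Hypothesis f1_derive : forall a (q : R), 0 < q -> is_derive q (1 : R) (f1 a)
  (- (2 * d%:R * f1 a q + k a ^+ 2 * f0 a q) / (4 * q)).
Local Notation D := (diff_term k).
Local Notation "''d_' i" := (diff_term k (delta_mx i 0)) (at level 8, i at level 2).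
Local Notation eval := (eval f0 f1).
Local Notation term := (term R d I).
Variables (lambda mu omega : R).
Hypothesis mu0 : mu != 0.
Hypothesis lmu0 : lambda + 2 * mu != 0.

(** The inner product of the equation with n gives (lambda + 2 mu) n . a = 0,
and then mu a = 0. *)
Lemma lame_symbol_injective (n a : V) : ip n n = 1 ->
  (forall i, mu * a i 0 + (lambda + mu) * n i 0 * ip n a = 0) -> a = 0.
Proof.
move=> n1 H.
have e : (lambda + 2 * mu) * ip n a = 0.
  transitivity (\sum_i n i 0 * (mu * a i 0 + (lambda + mu) * n i 0 * ip n a)).
    transitivity (mu * ip n a + (lambda + mu) * ip n a * ip n n).
      by rewrite n1; ring.
    set c := (lambda + mu) * ip n a.
    rewrite [X in mu * X]/ip [X in _ + _ * X]/ip !mulr_sumr -big_split/=.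
    by apply: eq_bigr => i _; rewrite /c; ring.
  by rewrite big1// => i _; rewrite H mulr0.
have {}e : ip n a = 0 by apply/eqP; move/eqP: e; rewrite mulf_eq0 (negbTE lmu0).
apply/matrixP => i j; rewrite ord1 mxE; have := H i.
by rewrite e mulr0 addr0 => /eqP; rewrite mulf_eq0 (negbTE mu0)/= => /eqP.
Qed.

Variables (Omega : set V) (nu : V -> V) (pts : I -> V).
Hypothesis oOmega : open Omega.
Hypothesis hnu : forall x, boundary Omega x -> exterior_unit_normal Omega x (nu x).
Hypothesis pts_off : forall x p, boundary Omega x -> x != pts p.
Local Notation offsets := (offsets pts).

Let away x : boundary Omega x -> away_from0 (offsets x).
Proof. by move=> bx p; rewrite /offsets subr_eq0; exact: pts_off. Qed.

Lemma normal_unit x : boundary Omega x -> ip (nu x) (nu x) = 1.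
Proof.
move=> /hnu[rho [g0 _] ->]; set g := grad rho x in g0 *.
have ng0 : 0 < enorm g by rewrite enorm_ip sqrtr_gt0 ip_gt0.
have e : ip g g = enorm g ^+ 2 by rewrite enorm_ip sqr_sqrtr// ip_ge0.
by rewrite ipZl ipZr e; field; rewrite gt_eqF.
Qed.

Lemma diff_is_normal (e : term) x v : (forall x, boundary Omega x -> eval (offsets x) e = 0) ->
  boundary Omega x ->
  eval (offsets x) (D v e) = ip v (nu x) * eval (offsets x) (D (nu x) e).
Proof.
move=> He bx; have [rho hrho en] := hnu bx.
pose tau := v - ip v (nu x) *: nu x.
have g0 : grad rho x != 0 by case: hrho.
have ng0 : 0 < enorm (grad rho x) by rewrite enorm_ip sqrtr_gt0 ip_gt0.
have gn : grad rho x = enorm (grad rho x) *: nu x.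
  by rewrite en scalerA divff ?gt_eqF// scale1r.
have : eval (offsets x) (D tau e) = 0.
  apply: (@tangential_derivative R d Omega x tau rho (fun y => eval (offsets y) e)
    (fun y v => eval (offsets y) (D v e)) (nu x)) => //.
  - rewrite gn ipZr /tau ipDl ipN ipZl normal_unit// mulr1 subrr mulr0//.
  - by move=> *; exact: eval_diffD.
  - by move=> *; exact: eval_diffZ.
  - near=> y => w s y' ey.
    apply: (eval_rel_line_derive f0_derive f1_derive _ ey).
    by near: y; apply: near_rel_away; exact: away.
  - move=> w; apply: (eval_rel_continuous f0_derive f1_derive).
    exact: away.
rewrite /tau -scaleNr eval_diffD eval_diffZ mulNr => /eqP.
by rewrite subr_eq0 => /eqP.
Unshelve. all: by end_near. Qed.

Definition cauchy_zero (w : 'I_d -> term) := forall x, boundary Omega x ->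
  forall i, eval (offsets x) (w i) = 0 /\ forall v, eval (offsets x) (D v (w i)) = 0.

(** Two applications of [diff_is_normal] show that the second derivatives of w
in directions u and v are (u . n) (v . n) a for a vector a; the Navier equation
says that a is in the kernel of the symbol. *)
Lemma cauchy_zero_diff w u : solution k f0 f1 lambda mu omega w ->
  cauchy_zero w -> cauchy_zero (fun i => D u (w i)).
Proof.
move=> sw cw x bx.
have n1 := normal_unit bx; set n := nu x in n1.
have second i v u' : eval (offsets x) (D v (D u' (w i))) =
    ip v n * (ip u' n * eval (offsets x) (D n (D n (w i)))).
  rewrite (diff_is_normal v (fun y By => (cw y By i).2 u') bx).
  by rewrite eval_diffC (diff_is_normal u' (fun y By => (cw y By i).2 n) bx).
pose a : V := \col_i eval (offsets x) (D n (D n (w i))).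
have a0 : a = 0.
  apply: (lame_symbol_injective n1) => i.
  have := sw (offsets x) i (away bx).
  rewrite /= diff_bigsum !eval_bigsum (cw x bx i).1 mulr0 add0r => <-.
  rewrite mxE; congr (_ + _).
    congr (_ * _); under eq_bigr do rewrite second mulrA.
    rewrite -mulr_suml -[LHS]mul1r -n1; congr (_ * _); apply: eq_bigr => b _.
    by rewrite ipC ip_delta.
  rewrite -mulrA; congr (_ * _); rewrite /ip mulr_sumr; apply: eq_bigr => b _.
  by rewrite second mxE !(ipC (delta_mx _ _)) !ip_delta.
move=> i; split; first by case: (cw x bx i).
move=> v; rewrite second.
have -> : eval (offsets x) (D n (D n (w i))) = a i 0 by rewrite mxE.
by rewrite a0 mxE !mulr0.
Qed.

Lemma cauchy_zero_iter w u : solution k f0 f1 lambda mu omega w -> cauchy_zero w ->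
  forall m x i, boundary Omega x -> eval (offsets x) (iter m (D u) (w i)) = 0.
Proof.
move=> sw cw m x i bx.
suff [_ H] : solution k f0 f1 lambda mu omega (fun i => iter m (D u) (w i)) /\
    cauchy_zero (fun i => iter m (D u) (w i)) by case: (H x bx i).
elim: m => [//|m [sm cm]]; split.
  exact: (solution_diff f0_derive f1_derive).
exact: cauchy_zero_diff.
Qed.

(** The gradient is the product of n and of a vector a, and the traction is the
symbol applied to a. *)
Lemma cauchy_zero_of_traction w :
  (forall x, boundary Omega x -> forall i, eval (offsets x) (w i) = 0) ->
  (forall x, boundary Omega x -> forall i, \sum_j
     (lambda * (\sum_a eval (offsets x) ('d_a (w a))) * (i == j)%:R +
      mu * (eval (offsets x) ('d_j (w i)) + eval (offsets x) ('d_i (w j)))) * nu x j 0 = 0) ->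
  cauchy_zero w.
Proof.
move=> w0 tr x bx.
have n1 := normal_unit bx.
have first i v : eval (offsets x) (D v (w i)) = ip v (nu x) * eval (offsets x) (D (nu x) (w i)).
  exact: diff_is_normal (fun y By => w0 y By i) bx.
have := tr x bx; set n := nu x in n1 first * => {}tr.
pose a : V := \col_i eval (offsets x) (D n (w i)).
have fa i j : eval (offsets x) ('d_j (w i)) = n j 0 * a i 0.
  by rewrite first ipC ip_delta mxE.
have a0 : a = 0.
  apply: (lame_symbol_injective n1) => i.
  rewrite -[RHS](tr i).
  have -> : \sum_a eval (offsets x) ('d_a (w a)) = ip n a.
    by apply: eq_bigr => b _; rewrite fa.
  transitivity (\sum_j (lambda * ip n a * ((i == j)%:R * n j 0) + mu * a i 0 * (n j 0 * n j 0)
     + mu * n i 0 * (n j 0 * a j 0))).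
    rewrite !big_split/= -!mulr_sumr -/(ip n n) -/(ip n a) n1.
    rewrite (bigD1 i)//= eqxx mulr1n big1 ?addr0; first by ring.
    by move=> j /negbTE ji; rewrite eq_sym ji mul0r.
  by apply: eq_bigr => j _; rewrite !fa; ring.
move=> i; split; first exact: w0.
move=> v; rewrite first.
have -> : eval (offsets x) (D n (w i)) = a i 0 by rewrite mxE.
by rewrite a0 mxE mulr0.
Qed.

End CauchyData.

(** * The radiated field as a term *)
Section FieldTerm.
Context {R : realType} {d : nat} {I : finType}.
Local Notation V := 'cV[R]_d.
Variables (k : bool -> R) (f0 f1 : bool -> R -> R).
Local Notation "''d_' i" := (diff_term k (delta_mx i 0)) (at level 8, i at level 2).
Variable (omega : R).

(** The derivative in direction l of the entry (i, j) of the Green tensor: the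
i-th component of the field of an elementary moment.  A single point of index
tt at relative position z is enough to express it. *)
Definition kernel (i j l : 'I_d) (z : V) : R :=
  eval f0 f1 (fun _ : unit => z) ('d_l (green_term k omega tt i j)).

Definition field_term (mom : I -> 'M[R]_d) (i : 'I_d) : term R d I :=
  \big[Add/Cst 0]_p \big[Add/Cst 0]_j \big[Add/Cst 0]_l
    Mul (Cst (mom p j l)) ('d_l (green_term k omega p i j)).

Lemma eval_field_term (mom : I -> 'M[R]_d) i (z : I -> V) :
  eval f0 f1 z (field_term mom i) =
  \sum_p \sum_j \sum_l mom p j l * kernel i j l (z p).
Proof.
rewrite eval_bigsum; apply: eq_bigr => p _.
rewrite eval_bigsum; apply: eq_bigr => j _.
by rewrite eval_bigsum; apply: eq_bigr => l _.
Qed.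

Hypothesis f0_derive : forall a (q : R), 0 < q -> is_derive q (1 : R) (f0 a) (f1 a q).
Hypothesis f1_derive : forall a (q : R), 0 < q -> is_derive q (1 : R) (f1 a)
  (- (2 * d%:R * f1 a q + k a ^+ 2 * f0 a q) / (4 * q)).
Variables (lambda mu : R).
Hypothesis mu0 : mu != 0.
Hypothesis lmu0 : lambda + 2 * mu != 0.
Hypothesis omega0 : omega != 0.
Hypothesis ks : k true ^+ 2 = omega ^+ 2 / mu.
Hypothesis kp : k false ^+ 2 = omega ^+ 2 / (lambda + 2 * mu).

Lemma field_solution (mom : I -> 'M[R]_d) :
  solution k f0 f1 lambda mu omega (field_term mom).
Proof.
apply: solution_bigsum => p; apply: solution_bigsum => j.
apply: solution_bigsum => l; apply: solution_scale.
by apply: solution_diff => //; exact: green_solution.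
Qed.

End FieldTerm.

Section RealParts.
Context {R : realType}.
Local Open Scope complex_scope.

Lemma ReD (x y : R[i]) : complex.Re (x + y) = complex.Re x + complex.Re y.
Proof. by case: x; case: y. Qed.

Lemma ReN (x : R[i]) : complex.Re (- x) = - complex.Re x.
Proof. by case: x. Qed.

Lemma Re_sum (J : finType) (F : J -> R[i]) :
  complex.Re (\sum_j F j) = \sum_j complex.Re (F j).
Proof. by apply: (big_morph (@complex.Re R)) => //; exact: ReD. Qed.

Lemma ReMn (x : R[i]) n : complex.Re (x *+ n) = complex.Re x *+ n.
Proof. by elim: n => [//|n IH]; rewrite !mulrS ReD IH. Qed.

End RealParts.

Section Link.
Context {R : realType} {d : nat}.
Local Notation V := 'cV[R]_d.
Variables (f0 f1 : R -> R -> R).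
Hypothesis Phi_f0 : forall k, 0 < k -> forall x y : V,
  complex.Re (Phi k x y) = f0 k (ip (x - y) (x - y)).
Hypothesis f0_derive : forall k, 0 < k -> forall q : R, 0 < q ->
  is_derive q (1 : R) (f0 k) (f1 k q).
Hypothesis f1_derive : forall k, 0 < k -> forall q : R, 0 < q ->
  is_derive q (1 : R) (f1 k) (- (2 * d%:R * f1 k q + k ^+ 2 * f0 k q) / (4 * q)).
Variables (lambda mu omega : R).
Hypothesis mu0 : 0 < mu.
Hypothesis lmu0 : 0 < lambda + 2 * mu.
Hypothesis omega0 : 0 < omega.

Definition wavenumber (a : bool) : R := omega / (if a then c_s mu else c_p lambda mu).
Local Notation k := wavenumber.
Local Notation F0 := (fun a => f0 (k a)).
Local Notation F1 := (fun a => f1 (k a)).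

Lemma wavenumber_gt0 a : 0 < k a.
Proof. by rewrite divr_gt0//; case: a; rewrite sqrtr_gt0. Qed.

Lemma wavenumber_s : k true ^+ 2 = omega ^+ 2 / mu.
Proof. by rewrite expr_div_n /c_s sqr_sqrtr// ltW. Qed.

Lemma wavenumber_p : k false ^+ 2 = omega ^+ 2 / (lambda + 2 * mu).
Proof. by rewrite expr_div_n /c_p sqr_sqrtr// ltW. Qed.

Let d0 a (q : R) : 0 < q -> is_derive q (1 : R) (F0 a) (F1 a q).
Proof. exact: f0_derive (wavenumber_gt0 a) _. Qed.
Let d1 a (q : R) : 0 < q -> is_derive q (1 : R) (F1 a)
  (- (2 * d%:R * F1 a q + k a ^+ 2 * F0 a q) / (4 * q)).
Proof. exact: f1_derive (wavenumber_gt0 a) _. Qed.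

Local Notation K := (kernel k F0 F1 omega).

Lemma Re_green (x y : V) i j : x != y ->
  complex.Re (green lambda mu omega x y i j) =
  eval F0 F1 (fun _ : unit => x - y) (green_term k omega tt i j).
Proof.
move=> xy.
pose rl := offsets (fun _ : unit => y).
have aw : away_from0 (rl x) by move=> p; rewrite /rl /offsets subr_eq0.
rewrite /green !mxE ReD ReMn !ReM_real -/(k true) -/(k false).
rewrite (Phi_f0 (wavenumber_gt0 true)) -[LHS]/(_ + omega ^- 2 * partial i (partial j
   (fun z => complex.Re (Phi (k true) z y - Phi (k false) z y))) x).
have -> : (fun z => complex.Re (Phi (k true) z y - Phi (k false) z y)) =
    (fun z => eval F0 F1 (rl z) (phi_term tt)).
  apply/funext => z; rewrite ReD ReN !Phi_f0 ?wavenumber_gt0//.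
  by rewrite /rl /offsets /= mulN1r.
have dj z : away_from0 (rl z) ->
    partial j (fun z => eval F0 F1 (rl z) (phi_term tt)) z =
    eval F0 F1 (rl z) (diff_term k (delta_mx j 0) (phi_term tt)).
  move=> az; have h := eval_rel_derive d0 d1 (delta_mx j 0) (phi_term tt) az.
  exact: (@derive_val _ _ _ _ _ _ _ h).
have -> : partial i (partial j (fun z => eval F0 F1 (rl z) (phi_term tt))) x =
    eval F0 F1 (rl x) (diff_term k (delta_mx i 0) (diff_term k (delta_mx j 0) (phi_term tt))).
  have h := eval_rel_derive d0 d1 (delta_mx i 0) (diff_term k (delta_mx j 0) (phi_term tt)) aw.
  rewrite -(@derive_val _ _ _ _ _ _ _ h).
  apply: near_eq_derive; near=> z; apply: dj.
  by near: z; exact: near_rel_away.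
rewrite -[RHS]/(k true ^+ 2 / omega ^+ 2 * (i == j)%:R * f0 (k true) (ip (x - y) (x - y)) +
  omega ^- 2 * eval F0 F1 (rl x) (diff_term k (delta_mx i 0) (diff_term k (delta_mx j 0) (phi_term tt)))).
by congr (_ + _); case: (i == j); rewrite ?mulr1n ?mulr0n ?mulr1 ?mulr0 ?mul0r.
Unshelve. all: by end_near. Qed.

(** Moving the source is moving the observer in the opposite direction, which
cancels the sign in the definition of the derivative of a distribution. *)
Lemma Re_green_source_derivative (x s : V) i j l : x != s ->
  - partial l (fun y => complex.Re (green lambda mu omega x y i j)) s = K i j l (x - s).
Proof.
move=> xs.
pose g := green_term k omega tt i j : term R d unit.
have aw : away_from0 (fun _ : unit => x - s) by move=> p; rewrite subr_eq0.
have h : is_derive s (delta_mx l 0 : V) (fun y => eval F0 F1 (fun _ : unit => x - y) g)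
    (eval F0 F1 (fun _ : unit => x - s) (diff_term k (- delta_mx l 0) g)).
  apply: is_derive_of_line.
  have -> : (fun t : R => eval F0 F1 (fun _ : unit => x - (s + t *: delta_mx l 0)) g) =
      (fun t : R => eval F0 F1 (fun _ : unit => x - s + t *: - delta_mx l 0) g).
    by apply/funext => t; congr (eval _ _ _ g); apply/funext => _; rewrite scalerN opprD addrA.
  exact: (eval_derive0 d0 d1).
have -> : partial l (fun y => complex.Re (green lambda mu omega x y i j)) s =
    eval F0 F1 (fun _ : unit => x - s) (diff_term k (- delta_mx l 0) g).
  rewrite -(@derive_val _ _ _ _ _ _ _ h).
  have sx : away_from0 (offsets (fun _ : unit => x) s).
    by move=> p; rewrite /offsets subr_eq0 eq_sym.
  apply: near_eq_derive; near=> y; apply: Re_green.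
  have /(_ tt) : away_from0 (offsets (fun _ : unit => x) y).
    by near: y; exact: near_rel_away.
  by rewrite /offsets subr_eq0 eq_sym.
by rewrite -(scaleN1r (delta_mx l 0)) eval_diffZ mulN1r opprK.
Unshelve. all: by end_near. Qed.

Lemma Re_radiated_field (S : source R d) (x : V) i :
  (forall p, x != @source_pos _ _ S p) ->
  complex.Re (radiated_field lambda mu S omega x i 0) =
  \sum_p \sum_j \sum_l @source_moment _ _ S p j l * K i j l (x - source_pos p).
Proof.
move=> xs; rewrite mxE Re_sum [RHS]exchange_big/=; apply: eq_bigr => j _.
rewrite /source_distr Re_sum; apply: eq_bigr => p _.
rewrite Re_sum; apply: eq_bigr => l _.
rewrite ReM_real; congr (_ * _).
rewrite /diff_distr /dirac_distr ReN.
exact: Re_green_source_derivative.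
Qed.

End Link.

(** * The singularity at a source point *)
Section KernelSingularity.
Context {R : realType} {d : nat}.
Local Notation V := 'cV[R]_d.
Variables (k : bool -> R) (f0 f1 : bool -> R -> R) (omega c0 : R).
Hypothesis prof : forall a, radial_profile d c0 (k a) (f0 a) (f1 a).
Hypothesis d2 : (2 <= d)%N.
Local Notation K := (kernel k f0 f1 omega).
(** Up to the factor - 1 / (2 q) this is the second derivative of the profile. *)
Let Tq a (q : R) := (2 * d%:R * f1 a q + k a ^+ 2 * f0 a q) / 2.

Lemma kernelE (i j l : 'I_d) (z : V) : let q := ip z z in
  K i j l z =
    2 * (k true ^+ 2 / omega ^+ 2) * (i == j)%:R * z l 0 * f1 true q
    + 2 * omega ^- 2 *
      ((d%:R + 2) * (z i 0 * z j 0 * z l 0) * (q^-1 * q^-1) * (Tq true q - Tq false q)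
       - z i 0 * z j 0 * z l 0 * q^-1 * (k true ^+ 2 * f1 true q - k false ^+ 2 * f1 false q)
       - ((l == i)%:R * z j 0 + (l == j)%:R * z i 0 + (i == j)%:R * z l 0) * q^-1
           * (Tq true q - Tq false q)).
Proof.
move=> q; rewrite /kernel /= -/q !ip_delta2 !ip_delta /Tq.
move: (f1 true q) (f1 false q) (f0 true q) (f0 false q) (q^-1) ((omega ^+ 2)^-1).
by move=> a b c e qi w; field.
Qed.

Definition kernel_limit (i j l : 'I_d) (v : V) : R :=
  - 2 * (k true ^+ 2 / omega ^+ 2) * (i == j)%:R * v l 0
  + (k true ^+ 2 - k false ^+ 2) / omega ^+ 2 *
    ((l == i)%:R * v j 0 + (l == j)%:R * v i 0 + (i == j)%:R * v l 0
     - d%:R * (v i 0 * v j 0 * v l 0)).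

(** The third derivatives of the fundamental solutions occur only in
differences, where the terms of order r^(- d - 1) cancel. *)
Lemma kernel_singularity (i j l : 'I_d) (v : V) : ip v v = 1 ->
  r ^+ d.-1 * K i j l (r *: v) @[r --> (0 : R)^'+] --> c0 * kernel_limit i j l v.
Proof.
move=> v1.
have hS a := slope_limit (prof a).
have hT : r ^+ (d - 2) * (Tq true (r ^+ 2) - Tq false (r ^+ 2)) @[r --> (0 : R)^'+] -->
    2^-1 * (- (c0 * k true ^+ 2) + -1 * - (c0 * k false ^+ 2)).
  apply: (cvg_at_right0_eq _ (rlimZ 2^-1 (rlimD (second_limit (prof true))
    (rlimZ (-1) (second_limit (prof false)))))) => r r0.
  by rewrite /Tq; field; rewrite gt_eqF.
have := rlimD (rlimZ (2 * (k true ^+ 2 / omega ^+ 2) * (i == j)%:R * v l 0) (hS true))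
  (rlimZ (2 * omega ^- 2) (rlimD (rlimD
    (rlimZ ((d%:R + 2) * (v i 0 * v j 0 * v l 0)) hT)
    (rlimZ (- (v i 0 * v j 0 * v l 0)) (rlimD (rlimZ (k true ^+ 2) (hS true)) (rlimZ (- k false ^+ 2) (hS false)))))
    (rlimZ (- ((l == i)%:R * v j 0 + (l == j)%:R * v i 0 + (i == j)%:R * v l 0)) hT))).
rewrite [X in _ --> X](_ : _ = c0 * kernel_limit i j l v); last first.
  by rewrite /kernel_limit; move: (omega ^+ 2)^-1 => w; field.
apply: cvg_at_right0_eq => r r0.
have rn0 : r != 0 by rewrite gt_eqF.
rewrite kernelE; set q := ip _ _.
have -> : q = r ^+ 2 by rewrite /q ipZl ipZr v1 mulr1.
have [d' ed] : exists d', d = d'.+2 by exists d.-2; case: (d) d2 => [|[]].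
have -> : r ^+ d.-1 = r ^+ (d - 2) * r by rewrite -exprSr; congr (_ ^+ _); rewrite ed subn2.
have -> : r ^+ d = r ^+ (d - 2) * r ^+ 2 by rewrite -exprD subnK.
rewrite !mxE; move: (Tq true _ - Tq false _) => T.
move: (omega ^+ 2)^-1 (r ^+ (d - 2)) => w rd.
move: (f1 true _) (f1 false _) => a b.
by field.
Qed.

Lemma kernel_regular (i j l : 'I_d) (z v : V) : z != 0 ->
  r ^+ d.-1 * K i j l (z + r *: v) @[r --> (0 : R)^'+] --> (0 : R).
Proof.
move=> z0.
have h1 : r ^+ d.-1 @[r --> (0 : R)^'+] --> (0 : R).
  have e : d.-1 = d.-2.+1 by case: (d) d2 => [|[]].
  have := cvg_at_right0_continuous (is_derive_continuous (is_derive_pow d.-2 (0 : R))).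
  by rewrite -e expr0n -subn1 subn_eq0 leqNgt d2.
have f0d a (q : R) : 0 < q -> is_derive q (1 : R) (f0 a) (f1 a q).
  exact: profile_derive (prof a) _.
have f1d a (q : R) : 0 < q -> is_derive q (1 : R) (f1 a)
    (- (2 * d%:R * f1 a q + k a ^+ 2 * f0 a q) / (4 * q)).
  exact: slope_derive (prof a) _.
have h2 : K i j l (z + r *: v) @[r --> (0 : R)^'+] --> K i j l (z + 0 *: v).
  apply: (@eval_cvg R d unit k f0 f1 f0d f1d _ _ _ (fun r _ => z + r *: v)).
    by move=> _; rewrite scale0r addr0.
  by move=> _ m; apply: cvg_at_right_filter; exact: line_coord_cvg.
by have := rlimM h1 h2; rewrite mul0r.
Qed.

End KernelSingularity.

Section MomentAlgebra.
Context {R : realType} {d : nat}.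
Local Notation V := 'cV[R]_d.
Variables (A B : R) (M : 'M[R]_d).
Implicit Types v : V.

(** For a unit vector v this is the leading coefficient, at a point with moment
M, of the field in the direction v (see [kernel_limit_symbol]); the factor
ip v v makes it homogeneous of degree 3. *)
Definition symbol (v : V) (i : 'I_d) : R :=
  ip v v * (- A * (\sum_l M i l * v l 0) + B * ((\sum_j M j i * v j 0) + \tr M * v i 0))
  - d%:R * B * (\sum_j (\sum_l M j l * v l 0) * v j 0) * v i 0.

Lemma symbol_scale c v i : symbol (c *: v) i = c ^+ 3 * symbol v i.
Proof.
have h (F : 'I_d -> R) : \sum_l F l * (c *: v) l 0 = c * \sum_l F l * v l 0.
  by rewrite mulr_sumr; apply: eq_bigr => l _; rewrite mxE; ring.
have h2 : \sum_j (\sum_l M j l * (c *: v) l 0) * (c *: v) j 0 =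
    c ^+ 2 * \sum_j (\sum_l M j l * v l 0) * v j 0.
  by rewrite mulr_sumr; apply: eq_bigr => j _; rewrite h mxE; ring.
by rewrite /symbol h2 !h ipZl ipZr mxE; ring.
Qed.

Lemma sum_delta (F : 'I_d -> R) i : \sum_l F l * (delta_mx i 0 : V) l 0 = F i.
Proof.
rewrite (bigD1 i)//= mxE !eqxx mulr1n mulr1 big1 ?addr0// => l li.
by rewrite mxE (negbTE li) mulr0.
Qed.

Lemma symbol_delta i m : symbol (delta_mx i 0) m =
  - A * M m i + B * (M i m + \tr M * (m == i)%:R) - d%:R * B * M i i * (m == i)%:R.
Proof.
rewrite /symbol ip_delta2 eqxx mulr1n mul1r !sum_delta.
by rewrite mxE eqxx andbT; ring.
Qed.

(** In the direction of the i-th basis vector, the i-th component ties M i i to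
the trace of M; the sum over i shows that the trace is zero, and so is the
diagonal.  The component m in the direction i and the component i in the
direction m are two independent relations between M m i and M i m. *)
Lemma symbol_injective : A - B != 0 -> A + B != 0 -> A + (d%:R - 1) * B != 0 ->
  (forall i m, symbol (delta_mx i 0) m = 0) -> M = 0.
Proof.
move=> AmB ApB AdB H.
have diag i : (A + (d%:R - 1) * B) * M i i = B * \tr M.
  have := H i i; rewrite symbol_delta eqxx mulr1n => e.
  apply/eqP; rewrite -subr_eq0; apply/eqP.
  by rewrite -[RHS]oppr0 -e; ring.
have tr0 : \tr M = 0.
  have : (A - B) * \tr M = 0.
    have : \sum_(i < d) ((A + (d%:R - 1) * B) * M i i) = \sum_(i < d) (B * \tr M).
      by apply: eq_bigr => i _; exact: diag.
    rewrite -mulr_sumr -/(mxtrace M) sumr_const card_ord -[(B * _) *+ d]mulr_natr => e.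
    transitivity ((A + (d%:R - 1) * B) * \tr M - B * \tr M * d%:R); first by ring.
    by rewrite e subrr.
  by move=> /eqP; rewrite mulf_eq0 (negbTE AmB)/= => /eqP.
have {}diag i : M i i = 0.
  by have /eqP := diag i; rewrite tr0 mulr0 mulf_eq0 (negbTE AdB)/= => /eqP.
apply/matrixP => i m; rewrite mxE; have [->//|im] := eqVneq i m.
have e1 := H i m; have e2 := H m i.
rewrite !symbol_delta tr0 (negbTE im) eq_sym (negbTE im) !mulr0n in e1 e2.
have : (A - B) * ((A + B) * M i m) = 0.
  have {}e1 : B * M i m = A * M m i by lra.
  have {}e2 : B * M m i = A * M i m by lra.
  transitivity (A * (A * M i m) - B * (B * M i m)); first by ring.
  by rewrite e1 -e2; ring.
by move=> /eqP; rewrite !mulf_eq0 (negbTE AmB) (negbTE ApB)/= => /eqP.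
Qed.

(** A continuity statement: rays in the direction of a basis vector may meet
other points, nearby directions do not. *)
Lemma symbol_limit (i j m : 'I_d) : i != j ->
  symbol (delta_mx i 0 + t *: delta_mx j 0) m @[t --> (0 : R)^'+]
    --> symbol (delta_mx i 0) m.
Proof.
move=> ij.
have h (t : R) (F : 'I_d -> R) :
    \sum_l F l * (delta_mx i 0 + t *: delta_mx j 0 : V) l 0 = F i + t * F j.
  rewrite -(sum_delta F i) -(sum_delta F j) mulr_sumr -big_split/=.
  by apply: eq_bigr => l _; rewrite !mxE; ring.
have E (t : R) : symbol (delta_mx i 0 + t *: delta_mx j 0) m =
    (1 + t * t) * (- A * (M m i + t * M m j) + B * (M i m + t * M j m + \tr M * ((m == i)%:R + t * (m == j)%:R)))
    - d%:R * B * ((M i i + t * M i j) + t * (M j i + t * M j j)) * ((m == i)%:R + t * (m == j)%:R).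
  rewrite /symbol; under [X in _ * X * _]eq_bigr do rewrite h.
  rewrite !h ipDl !ipDr !ipZl !ipZr !ip_delta2 !eqxx [j == i]eq_sym !(negbTE ij) !mxE !eqxx !andbT.
  by rewrite !mulr0n !mulr1n; ring.
have id0 : t @[t --> (0 : R)^'+] --> (0 : R).
  exact: (cvg_at_right0_continuous (is_derive_continuous (is_derive_var 0))).
have cst0 (a : R) : (fun=> a) t @[t --> (0 : R)^'+] --> a by exact: cvg_cst.
have lin (a b : R) : a + t * b @[t --> (0 : R)^'+] --> a.
  have := rlimD (cst0 a) (rlimZ b id0); rewrite mulr0 addr0.
  by apply: cvg_at_right0_eq => t _; rewrite mulrC.
have sq : 1 + t * t @[t --> (0 : R)^'+] --> (1 : R).
  by have := rlimD (cst0 1) (rlimM id0 id0); rewrite mulr0 addr0.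
have := rlimD
  (rlimM sq (rlimD (rlimZ (- A) (lin (M m i) (M m j)))
     (rlimZ B (rlimD (lin (M i m) (M j m)) (rlimZ (\tr M) (lin (m == i)%:R (m == j)%:R))))))
  (rlimZ (- (d%:R * B)) (rlimM (rlimD (lin (M i i) (M i j)) (rlimM id0 (lin (M j i) (M j j))))
     (lin (m == i)%:R (m == j)%:R))).
move=> hl; match type of hl with (_ --> ?l) =>
  have -> : symbol (delta_mx i 0) m = l end.
  by rewrite symbol_delta; ring.
by apply: (cvg_at_right0_eq _ hl) => t _; rewrite E; ring.
Qed.

End MomentAlgebra.

(** * Uniqueness of the moments *)
Section Rays.
Context {R : realType} {d : nat} {I : finType}.
Local Notation V := 'cV[R]_d.
Variables (pts : I -> V).

Lemma ray_parameters_eq (i j : 'I_d) (a b t t' : R) : i != j -> 0 < a ->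
  a *: (delta_mx i 0 + t *: delta_mx j 0) = b *: (delta_mx i 0 + t' *: delta_mx j 0) :> V ->
  t = t'.
Proof.
move=> ij a0 /matrixP H.
have := H i 0; have := H j 0; rewrite !mxE !eqxx /= [j == i]eq_sym !(negbTE ij) /=.
rewrite !mulr0 !add0r !addr0 !mulr1 => h1 h2.
by move: h1; rewrite -h2 => /mulfI -> //; rewrite gt_eqF.
Qed.

(** Each point lies on the ray of at most one of these directions, by
[ray_parameters_eq]. *)
Lemma rays_avoid_points (s : V) (i j : 'I_d) : i != j ->
  \forall t \near (0 : R)^'+, forall p (r : R), pts p != s -> 0 < r ->
    s + r *: (delta_mx i 0 + t *: delta_mx j 0) != pts p.
Proof.
move=> ij; apply: filter_forall => p.
have [[t1 t10 [r1 r10 e1]]|no] := pselect (exists2 t1 : R, 0 < t1 &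
    exists2 r1 : R, 0 < r1 & s + r1 *: (delta_mx i 0 + t1 *: delta_mx j 0) = pts p).
  near=> t => r _ r0; apply/eqP => e2.
  have tt1 : t < t1 by near: t; exact: nbhs_right_lt.
  have : t = t1.
    apply: (@ray_parameters_eq i j r r1) => //.
    by apply: (addrI s); rewrite e1.
  by move/eqP; rewrite lt_eqF.
near=> t => r _ r0; apply/eqP => e2; apply: no; exists t.
  by near: t; exact: nbhs_right_gt.
by exists r.
Unshelve. all: by end_near. Qed.

Lemma ray_meets_boundary (Omega : set V) (s v : V) :
  open Omega -> bounded_set Omega -> Omega s -> v != 0 ->
  exists2 t : R, 0 < t & boundary Omega (s + t *: v).
Proof.
move=> oO [M [Mr HM]] Os v0.
have v0' : 0 < `|v| by rewrite normr_gt0.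
pose B := `|M| + 1.
have bO x : Omega x -> `|x| <= B.
  by apply: HM; rewrite /B (le_lt_trans (ler_norm M))// ltrDl.
pose T := (B + 1 + `|s|) / `|v|.
have T0 : 0 < T by rewrite divr_gt0// /B ltr_wpDr// ltr_wpDl ?addr_ge0.
have nO : ~ Omega (s + T *: v).
  move=> /bO; rewrite leNgt => /negP; apply.
  have : `|T *: v| <= `|s + T *: v| + `|s|.
    by rewrite -[X in `|X| <= _](addKr s) addrC -[`|s|]normrN; exact: ler_normD.
  rewrite normrZ gtr0_norm// divfK ?gt_eqF//.
  by lra.
have [u [/andP[u0 u1] bu]] := segment_meets_boundary oO Os nO.
rewrite addrAC subrr add0r scalerA in bu.
exists (u * T) => //; rewrite mulr_gt0// lt_neqAle u0 andbT eq_sym.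
apply/eqP => u00; case: bu => _; apply.
by rewrite u00 mul0r scale0r addr0 /interior nbhsE; exists Omega.
Qed.

End Rays.

Lemma lame_sum_gt0 (R : realType) (d : nat) (lambda mu : R) : (2 <= d)%N ->
  0 < mu -> 0 < d%:R * lambda + 2 * mu -> 0 < lambda + mu.
Proof.
move=> d2 mu0 h; have [l0|l0] := leP 0 lambda; first by rewrite ltr_wpDl.
have : (d%:R - 2) * lambda <= 0 by rewrite nmulr_lle0// subr_ge0 ler_nat.
by lra.
Qed.

Lemma lame_p_gt0 (R : realType) (d : nat) (lambda mu : R) : (2 <= d)%N ->
  0 < mu -> 0 < d%:R * lambda + 2 * mu -> 0 < lambda + 2 * mu.
Proof. by move=> d2 mu0 h; have := lame_sum_gt0 d2 mu0 h; lra. Qed.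

Section Uniqueness.
Context {R : realType} {d : nat} {I : finType}.
Local Notation V := 'cV[R]_d.
Variables (k : bool -> R) (f0 f1 : bool -> R -> R) (c0 lambda mu omega : R).
Hypothesis prof : forall a, radial_profile d c0 (k a) (f0 a) (f1 a).
Hypothesis c00 : 0 < c0.
Hypothesis d2 : (2 <= d)%N.
Hypothesis mu0 : 0 < mu.
Hypothesis lame0 : 0 < d%:R * lambda + 2 * mu.
Hypothesis omega0 : 0 < omega.
Hypothesis ks : k true ^+ 2 = omega ^+ 2 / mu.
Hypothesis kp : k false ^+ 2 = omega ^+ 2 / (lambda + 2 * mu).
Variables (Omega : set V) (nu : V -> V) (pts : I -> V) (mom : I -> 'M[R]_d).
Hypothesis oOmega : open Omega.
Hypothesis bOmega : bounded_set Omega.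
Hypothesis hnu : forall x, boundary Omega x -> exterior_unit_normal Omega x (nu x).
Hypothesis pts_in : forall p, Omega (pts p).
Local Notation W := (field_term k omega mom).
Hypothesis cW : cauchy_zero k f0 f1 Omega pts W.

Let f0d a (q : R) : 0 < q -> is_derive q (1 : R) (f0 a) (f1 a q).
Proof. exact: profile_derive (prof a) _. Qed.
Let f1d a (q : R) : 0 < q -> is_derive q (1 : R) (f1 a)
    (- (2 * d%:R * f1 a q + k a ^+ 2 * f0 a q) / (4 * q)).
Proof. exact: slope_derive (prof a) _. Qed.

Let dR2 : 2 <= d%:R :> R. Proof. by rewrite ler_nat. Qed.

Let lm0 : 0 < lambda + mu. Proof. exact: lame_sum_gt0 d2 mu0 lame0. Qed.
Let lmu0 : 0 < lambda + 2 * mu. Proof. exact: lame_p_gt0 d2 mu0 lame0. Qed.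

Lemma boundary_off_points x p : boundary Omega x -> x != pts p.
Proof.
move=> [_ nO]; apply/eqP => e; apply: nO.
by rewrite e /interior nbhsE; exists Omega.
Qed.

(** The ray meets the boundary, where the field vanishes to infinite order. *)
Lemma field_zero_on_ray p0 v : v != 0 ->
  (forall p (r : R), pts p != pts p0 -> 0 < r -> pts p0 + r *: v != pts p) ->
  forall i (r : R), 0 < r ->
    \sum_p \sum_j \sum_l mom p j l *
      kernel k f0 f1 omega i j l (pts p0 - pts p + r *: v) = 0.
Proof.
move=> v0 avoid i r r0.
have [t0 t00 bt] := ray_meets_boundary oOmega bOmega (pts_in p0) v0.
rewrite -(eval_field_term k f0 f1 omega mom i (fun p => pts p0 - pts p + r *: v)).
apply: (eval_flat_ray f0d f1d (t0 := t0)) => //.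
  move=> p t tp; rewrite addrAC subr_eq0.
  have [e|ne] := eqVneq (pts p) (pts p0); last exact: avoid.
  by rewrite e -subr_eq0 addrAC subrr add0r scaler_eq0 negb_or gt_eqF.
move=> n; rewrite -(rel_line pts (pts p0) v t0).
have sW := field_solution f0d f1d (lt0r_neq0 mu0) (lt0r_neq0 lmu0)
  (lt0r_neq0 omega0) ks kp mom.
exact: (cauchy_zero_iter f0d f1d (lt0r_neq0 mu0) (lt0r_neq0 lmu0) oOmega hnu
  boundary_off_points v sW cW).
Qed.

(** Several indices may carry the same position, as happens when a point is
common to both sources. *)
Definition total_moment p0 : 'M[R]_d := \sum_(p | pts p == pts p0) mom p.

Let A := mu^-1 + (lambda + 2 * mu)^-1.
Let B := mu^-1 - (lambda + 2 * mu)^-1.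

Lemma kernel_limit_symbol (M : 'M[R]_d) v i : ip v v = 1 ->
  \sum_j \sum_l M j l * kernel_limit k omega i j l v = symbol A B M v i.
Proof.
move=> v1; rewrite /symbol v1 mul1r /kernel_limit ks kp.
have on0 : omega != 0 by exact: lt0r_neq0.
have m0 : mu != 0 by exact: lt0r_neq0.
have l0 : lambda + 2 * mu != 0 by exact: lt0r_neq0.
have -> : omega ^+ 2 / mu / omega ^+ 2 = mu^-1 by field; rewrite on0 m0.
have -> : (omega ^+ 2 / mu - omega ^+ 2 / (lambda + 2 * mu)) / omega ^+ 2 = B.
  by rewrite /B; field; rewrite on0 m0 l0.
have -> : A = 2 / mu - B by rewrite /A /B; field; rewrite l0 m0.
move: (mu^-1) B => c b.
have s1 : \sum_l M i l * v l 0 = \sum_j \sum_l (i == j)%:R * (M j l * v l 0).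
  rewrite [RHS](bigD1 i)//= [X in _ = _ + X]big1 ?addr0; last first.
    by move=> j ji; rewrite big1// => l _; rewrite eq_sym (negbTE ji) mul0r.
  by apply: eq_bigr => l _; rewrite eqxx mul1r.
have s2 : \sum_j M j i * v j 0 = \sum_j \sum_l (l == i)%:R * (M j l * v j 0).
  apply: eq_bigr => j _; rewrite (bigD1 i)//= eqxx mul1r big1 ?addr0// => l li.
  by rewrite (negbTE li) mul0r.
have s3 : \tr M * v i 0 = \sum_j \sum_l (l == j)%:R * (M j l * v i 0).
  rewrite /mxtrace mulr_suml; apply: eq_bigr => j _.
  rewrite (bigD1 j)//= eqxx mul1r big1 ?addr0// => l li.
  by rewrite (negbTE li) mul0r.
have s4 : (\sum_j (\sum_l M j l * v l 0) * v j 0) * v i 0 =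
    \sum_j \sum_l M j l * v l 0 * v j 0 * v i 0.
  by rewrite mulr_suml; apply: eq_bigr => j _; rewrite !mulr_suml.
rewrite s2 s3 -[X in _ - X]mulrA s4 s1 !mulrDr !mulr_sumr -!big_split -sumrB/=.
apply: eq_bigr => j _; rewrite !mulr_sumr -!big_split -sumrB/=.
by apply: eq_bigr => l _; ring.
Qed.

(** Multiply the field on the ray by r^(d - 1) and let r tend to 0: only the
indices located at [pts p0] contribute to the limit. *)
Lemma symbol_total_moment_unit p0 v i : ip v v = 1 ->
  (forall p (r : R), pts p != pts p0 -> 0 < r -> pts p0 + r *: v != pts p) ->
  symbol A B (total_moment p0) v i = 0.
Proof.
move=> v1 avoid.
have v0 : v != 0.
  apply/eqP => e; move: v1; rewrite e -(scale0r (0 : V)) ipZl mul0r => /eqP.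
  by rewrite eq_sym oner_eq0.
pose K := @kernel R d k f0 f1 omega.
pose L p j l := if pts p == pts p0 then c0 * kernel_limit k omega i j l v else 0.
have lim_term p j l : r ^+ d.-1 * K i j l (pts p0 - pts p + r *: v)
    @[r --> (0 : R)^'+] --> L p j l.
  rewrite /L; have [e|ne] := eqVneq (pts p) (pts p0).
    rewrite e subrr; under eq_fun do rewrite add0r.
    exact: kernel_singularity.
  by apply: kernel_regular => //; rewrite subr_eq0 eq_sym.
have lim_sum : \sum_p \sum_j \sum_l mom p j l * (r ^+ d.-1 * K i j l (pts p0 - pts p + r *: v))
    @[r --> (0 : R)^'+] --> \sum_p \sum_j \sum_l mom p j l * L p j l.
  do 3 (apply: cvg_big => [|? _]; first exact: add_continuous).
  exact: rlimZ.
have lim0 : \sum_p \sum_j \sum_l mom p j l * (r ^+ d.-1 * K i j l (pts p0 - pts p + r *: v))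
    @[r --> (0 : R)^'+] --> (0 : R).
  apply: (cvg_at_right0_eq (g := fun=> 0)); last exact: cvg_cst.
  move=> r r0; transitivity (r ^+ d.-1 * (\sum_p \sum_j \sum_l mom p j l *
      kernel k f0 f1 omega i j l (pts p0 - pts p + r *: v))); last first.
    by rewrite (field_zero_on_ray v0 avoid i r0) mulr0.
  rewrite mulr_sumr; apply: eq_bigr => p _; rewrite mulr_sumr; apply: eq_bigr => j _.
  by rewrite mulr_sumr; apply: eq_bigr => l _; rewrite mulrCA.
have e : \sum_p \sum_j \sum_l mom p j l * L p j l = 0.
  exact: (cvg_unique _ lim_sum lim0).
apply: (mulfI (lt0r_neq0 c00)); rewrite mulr0 -[RHS]e -kernel_limit_symbol//.
rewrite mulr_sumr [RHS]exchange_big; apply: eq_bigr => j _.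
rewrite mulr_sumr [RHS]exchange_big; apply: eq_bigr => l _.
rewrite /total_moment summxE big_mkcond/= mulr_suml mulr_sumr.
by apply: eq_bigr => p _; rewrite /L; case: ifP => _; ring.
Qed.

Lemma symbol_total_moment p0 v i : v != 0 ->
  (forall p (r : R), pts p != pts p0 -> 0 < r -> pts p0 + r *: v != pts p) ->
  symbol A B (total_moment p0) v i = 0.
Proof.
move=> v0 avoid; have n0 : 0 < Num.sqrt (ip v v) by rewrite sqrtr_gt0 ip_gt0.
set n := Num.sqrt _ in n0.
have ev : v = n *: (n^-1 *: v) by rewrite scalerA divff ?scale1r// gt_eqF.
rewrite ev symbol_scale symbol_total_moment_unit ?mulr0//.
  rewrite ipZl ipZr -(sqr_sqrtr (ip_ge0 v)) -/n.
  by field; rewrite gt_eqF.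
move=> p r pn r0; rewrite scalerA; apply: avoid => //.
by rewrite divr_gt0.
Qed.

Lemma total_moment_zero p0 : total_moment p0 = 0.
Proof.
have iB : 0 < B.
  rewrite /B subr_gt0 ltf_pV2 ?posrE//.
  by have := lm0; lra.
apply: (@symbol_injective R d A B).
- rewrite (_ : A - B = 2 / (lambda + 2 * mu)); last by rewrite /A /B; field; rewrite !gt_eqF.
  by rewrite mulf_neq0// invr_eq0 gt_eqF.
- rewrite (_ : A + B = 2 / mu); last by rewrite /A /B; field; rewrite !gt_eqF.
  by rewrite mulf_neq0// invr_eq0 gt_eqF.
- have A0 : 0 < A by rewrite addr_gt0// invr_gt0.
  rewrite gt_eqF// addr_gt0// mulr_gt0//.
  by have := dR2; lra.
move=> i m.
have [j ij] : exists j : 'I_d, i != j.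
  have d0 : (0 < d)%N by exact: leq_trans d2.
  pose o0 := Ordinal d0; pose o1 := Ordinal d2.
  by have [->|] := eqVneq i o0; [exists o1|exists o0].
have h0 : symbol A B (total_moment p0) (delta_mx i 0 + t *: delta_mx j 0) m
    @[t --> (0 : R)^'+] --> (0 : R).
  apply: (@cvg_trans _ ((fun=> (0 : R)) t @[t --> (0 : R)^'+])); last exact: cvg_cst.
  apply: near_eq_cvg; near=> t; rewrite symbol_total_moment//.
    apply/eqP => /matrixP/(_ i 0); rewrite !mxE !eqxx (negbTE ij)/= mulr0 addr0.
    by move/eqP; rewrite oner_eq0.
  by near: t; exact: rays_avoid_points.
by apply: (cvg_unique _ (@symbol_limit R d A B (total_moment p0) i j m ij) h0).
Unshelve. all: by end_near. Qed.

End Uniqueness.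

(** * Comparison of two sources *)
Lemma sum_by_position (I : finType) (X : eqType) (C : nmodType) (pos : I -> X) (F : I -> C) :
  (forall p0, \sum_(p | pos p == pos p0) F p = 0) -> \sum_p F p = 0.
Proof.
move=> H.
pose rep p := odflt p [pick q | pos q == pos p].
have repE p : pos (rep p) = pos p.
  by rewrite /rep; case: pickP => [q /eqP|//].
have rep_eq p q : pos p = pos q -> rep p = rep q.
  move=> e; rewrite /rep (@eq_pick _ _ (fun q' => pos q' == pos q)); last first.
    by move=> q'; rewrite e.
  by case: pickP => [//|/(_ q)]; rewrite eqxx.
rewrite (partition_big rep xpredT)//= big1// => j _.
have [p1 /eqP e1|no] := pickP (fun p => rep p == j); last by rewrite big_pred0.
rewrite -[RHS](H p1); apply: eq_bigl => p.
apply/eqP/eqP => [ep|/rep_eq ->//].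
by rewrite -(repE p) ep -e1 repE.
Qed.

Section Difference.
Context {R : realType} {d : nat}.
Local Notation V := 'cV[R]_d.
Local Open Scope complex_scope.

Definition Re_jacobian (u : V -> 'cV[R[i]]_d) (x : V) (i j : 'I_d) : R :=
  partial j (fun z => complex.Re (u z i 0)) x.

Lemma Re_traction (lambda mu : R) (nu : V -> V) (u : V -> 'cV[R[i]]_d) (x : V) i :
  complex.Re (traction lambda mu nu u x i 0) =
  \sum_j (lambda * (\sum_a Re_jacobian u x a a) * (i == j)%:R +
    mu * (Re_jacobian u x i j + Re_jacobian u x j i)) * nu x j 0.
Proof.
rewrite /traction mxE Re_sum; apply: eq_bigr => j _.
rewrite [in X in _ * X]mxE mulrC ReM_real mulrC; congr (_ * _).
rewrite /stress !mxE ReD ReMn !ReM_real ReD /mxtrace Re_sum.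
congr (_ + _).
  under eq_bigr do rewrite mxE.
  by case: (i == j); rewrite ?mulr1n ?mulr0n ?mulr1 ?mulr0.
Qed.

Variables (S S' : source R d).

(** The source S - S', as a family of points with moments. *)
Definition both_index : finType := ('I_(source_num S) + 'I_(source_num S'))%type.

Definition both_pos (p : both_index) : V :=
  match p with inl q => source_pos q | inr q => source_pos q end.

Definition diff_moment (p : both_index) : 'M[R]_d :=
  match p with inl q => source_moment q | inr q => - source_moment q end.

Lemma eq_distr_of_moments :
  (forall p0, total_moment both_pos diff_moment p0 = 0) -> eq_distr S S'.
Proof.
move=> H k phi _; apply/eqP; rewrite -subr_eq0; apply/eqP.
pose T l (s : V) : R[i] := diff_distr l (dirac_distr s) phi.
transitivity (\sum_(p : both_index) \sum_l (diff_moment p k l)%:C * T l (both_pos p)).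
  rewrite big_sumType /= /source_distr -sumrN; congr (_ + _).
  apply: eq_bigr => q _; rewrite -sumrN; apply: eq_bigr => l _.
  by rewrite mxE rmorphN mulNr.
apply: (sum_by_position (pos := both_pos)) => p0.
transitivity (\sum_l (total_moment both_pos diff_moment p0 k l)%:C * T l (both_pos p0)).
  rewrite exchange_big; apply: eq_bigr => l _.
  rewrite /total_moment summxE rmorph_sum mulr_suml.
  by apply: eq_bigr => p /eqP ->.
by rewrite H big1// => l _; rewrite mxE rmorph0 mul0r.
Qed.

Variables (f0 f1 : R -> R -> R).
Hypothesis Phi_f0 : forall k, 0 < k -> forall x y : V,
  complex.Re (Phi k x y) = f0 k (ip (x - y) (x - y)).
Hypothesis f0_derive : forall k, 0 < k -> forall q : R, 0 < q ->
  is_derive q (1 : R) (f0 k) (f1 k q).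
Hypothesis f1_derive : forall k, 0 < k -> forall q : R, 0 < q ->
  is_derive q (1 : R) (f1 k) (- (2 * d%:R * f1 k q + k ^+ 2 * f0 k q) / (4 * q)).
Variables (lambda mu omega : R).
Hypothesis mu0 : 0 < mu.
Hypothesis lmu0 : 0 < lambda + 2 * mu.
Hypothesis omega0 : 0 < omega.
Local Notation k := (wavenumber lambda mu omega).
Local Notation F0 := (fun a => f0 (k a)).
Local Notation F1 := (fun a => f1 (k a)).
Local Notation u := (radiated_field lambda mu S omega).
Local Notation u' := (radiated_field lambda mu S' omega).
Local Notation W := (field_term k omega diff_moment).

Let d0 a (q : R) : 0 < q -> is_derive q (1 : R) (F0 a) (F1 a q).
Proof. exact: f0_derive (wavenumber_gt0 mu0 lmu0 omega0 a) _. Qed.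
Let d1 a (q : R) : 0 < q -> is_derive q (1 : R) (F1 a)
  (- (2 * d%:R * F1 a q + k a ^+ 2 * F0 a q) / (4 * q)).
Proof. exact: f1_derive (wavenumber_gt0 mu0 lmu0 omega0 a) _. Qed.

Lemma Re_radiated_field_term (S0 : source R d) (x : V) i :
  away_from0 (offsets (@source_pos _ _ S0) x) ->
  complex.Re (radiated_field lambda mu S0 omega x i 0) =
  eval F0 F1 (offsets (@source_pos _ _ S0) x) (field_term k omega (@source_moment _ _ S0) i).
Proof.
move=> aw; rewrite eval_field_term.
apply: (Re_radiated_field Phi_f0 f0_derive f1_derive) => // p.
by have := aw p; rewrite /offsets subr_eq0.
Qed.

Lemma Re_radiated_field_derive (S0 : source R d) (x : V) i j :
  away_from0 (offsets (@source_pos _ _ S0) x) ->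
  is_derive x (delta_mx j 0 : V)
    (fun z => complex.Re (radiated_field lambda mu S0 omega z i 0))
    (Re_jacobian (radiated_field lambda mu S0 omega) x i j).
Proof.
move=> aw; apply: derivableP.
apply: near_eq_derivable; last first.
  have [h _] := eval_rel_derive d0 d1 (delta_mx j 0)
    (field_term k omega (@source_moment _ _ S0) i) aw.
  exact: h.
near=> z; apply/esym; apply: Re_radiated_field_term.
by near: z; exact: near_rel_away.
Unshelve. all: by end_near. Qed.

Lemma away_both (x : V) : away_from0 (offsets both_pos x) ->
  away_from0 (offsets (@source_pos _ _ S) x) /\ away_from0 (offsets (@source_pos _ _ S') x).
Proof. by move=> H; split=> p; [exact: (H (inl p))|exact: (H (inr p))]. Qed.

Lemma field_difference (x : V) i : away_from0 (offsets both_pos x) ->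
  eval F0 F1 (offsets both_pos x) (W i) = complex.Re (u x i 0) - complex.Re (u' x i 0).
Proof.
move=> /away_both[aS aS']; rewrite !Re_radiated_field_term// !eval_field_term.
rewrite big_sumType/= -sumrN; congr (_ + _); apply: eq_bigr => p _.
rewrite -sumrN; apply: eq_bigr => j _; rewrite -sumrN; apply: eq_bigr => l _.
by rewrite mxE mulNr.
Qed.

Lemma gradient_difference (x : V) i j : away_from0 (offsets both_pos x) ->
  eval F0 F1 (offsets both_pos x) (diff_term k (delta_mx j 0) (W i)) =
  Re_jacobian u x i j - Re_jacobian u' x i j.
Proof.
move=> aw; have [aS aS'] := away_both aw.
have h := is_derive_sub (Re_radiated_field_derive i j aS) (Re_radiated_field_derive i j aS').
have h' := eval_rel_derive d0 d1 (delta_mx j 0) (W i) aw.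
rewrite -(@derive_val _ _ _ _ _ _ _ h) -(@derive_val _ _ _ _ _ _ _ h').
apply: near_eq_derive; near=> z; apply: field_difference.
by near: z; exact: near_rel_away.
Unshelve. all: by end_near. Qed.

End Difference.

Theorem theorem4p1 (R : realType) (d : nat) (hd : d = 2%N \/ d = 3%N)
  (Omega : set 'cV[R]_d) (nu : 'cV[R]_d -> 'cV[R]_d)
  (hOmega : bounded_domain Omega) (hC2 : C2_boundary Omega)
  (hnu : forall x, boundary Omega x -> exterior_unit_normal Omega x (nu x))
  (lambda mu : R) (hmu : 0 < mu) (hlambda : 0 < d%:R * lambda + 2 * mu)
  (eta omega_star : R) (heta : 1 < eta) (homega : 0 < omega_star)
  (S S' : source R d)
  (hS : admissible_source Omega omega_star S)
  (hS' : admissible_source Omega omega_star S')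
  (hdata : forall N : nat, (1 <= N)%N ->
    forall omega, frequencies eta omega_star N omega ->
    forall c, c = c_p lambda mu \/ c = c_s mu ->
    forall x, boundary Omega x ->
      radiated_field lambda mu S (c * omega) x =
        radiated_field lambda mu S' (c * omega) x /\
      traction lambda mu nu (radiated_field lambda mu S (c * omega)) x =
        traction lambda mu nu (radiated_field lambda mu S' (c * omega)) x) :
  eq_distr S S'.
Proof.
have d2 : (2 <= d)%N by case: hd => ->.
have lmu0 := lame_p_gt0 d2 hmu hlambda.
have [oO _ _ bO] := hOmega.
have [_ _ inS _] := hS; have [_ _ inS' _] := hS'.
set omega := c_s mu * omega_star.
have omega0 : 0 < omega by rewrite mulr_gt0// sqrtr_gt0.
have data x : boundary Omega x ->
    radiated_field lambda mu S omega x = radiated_field lambda mu S' omega x /\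
    traction lambda mu nu (radiated_field lambda mu S omega) x =
      traction lambda mu nu (radiated_field lambda mu S' omega) x.
  apply: (hdata 1%N) => //; last by right.
  by exists 1%N => //=; rewrite expr0 mul1r.
have [c0 [f0 [f1 [c00 prof]]]] := @fundamental_solution_profile R d hd.
have Phi_f0 k : 0 < k -> forall x y : 'cV[R]_d,
    complex.Re (Phi k x y) = f0 k (ip (x - y) (x - y)) by move=> /prof[].
have df0 k : 0 < k -> forall q : R, 0 < q -> is_derive q (1 : R) (f0 k) (f1 k q).
  by move=> /prof[[]].
have df1 k : 0 < k -> forall q : R, 0 < q ->
    is_derive q (1 : R) (f1 k) (- (2 * d%:R * f1 k q + k ^+ 2 * f0 k q) / (4 * q)).
  by move=> /prof[[]].
pose k := wavenumber lambda mu omega.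
have kprof a : radial_profile d c0 (k a) (f0 (k a)) (f1 (k a)).
  by case: (prof (k a) (wavenumber_gt0 hmu lmu0 omega0 a)).
have inO p : Omega (both_pos (S := S) (S' := S') p) by case: p.
apply: eq_distr_of_moments => p0.
apply: (total_moment_zero kprof c00 d2 hmu hlambda omega0
  (wavenumber_s lambda omega hmu) (wavenumber_p omega lmu0) oO bO hnu inO).
have off x p : boundary Omega x -> x != both_pos (S := S) (S' := S') p.
  exact: (boundary_off_points oO inO).
have away x : boundary Omega x -> away_from0 (offsets (@both_pos _ _ S S') x).
  by move=> bx p; rewrite /offsets subr_eq0; exact: off.
apply: (cauchy_zero_of_traction
  (fun a q q0 => profile_derive (kprof a) q0) (fun a q q0 => slope_derive (kprof a) q0)
  (lt0r_neq0 hmu) (lt0r_neq0 lmu0) oO hnu off).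
- move=> x bx i; rewrite (field_difference Phi_f0 df0 df1 hmu lmu0 omega0)//; last exact: away.
  by rewrite (data x bx).1 subrr.
- move=> x bx i.
  have := Re_traction lambda mu nu (radiated_field lambda mu S omega) x i.
  rewrite (data x bx).2 Re_traction => e.
  rewrite -[RHS](subrr (\sum_j (lambda *
      (\sum_a Re_jacobian (radiated_field lambda mu S omega) x a a) * (i == j)%:R +
    mu * (Re_jacobian (radiated_field lambda mu S omega) x i j +
      Re_jacobian (radiated_field lambda mu S omega) x j i)) * nu x j 0)).
  rewrite -[X in _ = _ - X]e -sumrB; apply: eq_bigr => j _.
  have G i' j' := gradient_difference Phi_f0 df0 df1 hmu lmu0 omega0 i' j' (away x bx).
  rewrite !G; under [X in lambda * X]eq_bigr do rewrite G.
  by rewrite sumrB; ring.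
Qed.
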